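(* Suppose that $\mu$ satisfies a Poincaré inequality with constant $C_P$, i.e. $\mathrm{Var}_\mu(f)\le C_P\int\Gamma(f,f)\,d\mu$ for all smooth $f$. Then for every $p>2$, for all $f\in L^p(\mu)$ and all $t\ge0$, $$N_p(P_tf)\le K_p\,e^{-\lambda_p t}\,N_p(f)\qquad\text{with}\quad \lambda_p=\frac{1}{p\,C_P},\quad K_p=4^{1-\frac1p}.$$ If $p=2^k$ for an integer $k\ge1$, the same inequality holds with the improved values $$\lambda_{2^k}=\frac{2}{2^k\,C_P},\qquad K_p=4^{1-\frac2p}.$$ Consequently, for $1<p<2$, for all $f\in L^p(\mu)$ and all $t\ge0$, $N_p(P_tf)\le K_p\,e^{-\lambda_p t}\,N_p(f)$ with $K_p=2$ and $\lambda_p=\lambda_{p/(p-1)}$.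
   Context: Setting. $(X_t)$ is a Markov process with infinitesimal generator $L$ and Polish state space $E$. The extended domain of $L$ contains a nice core $\mathcal D$ of uniformly continuous functions, which contains the constants and is an algebra; functions in $\mathcal D$ are called smooth. The carré du champ operator is $\Gamma(f,g)=\frac12\left(L(fg)-f\,Lg-g\,Lf\right)$, and the associated Dirichlet form is given for smooth $f$ by $\mathcal E(f,f)=-\int f\,Lf\,d\mu=\int\Gamma(f,f)\,d\mu$. The generator $L$ is $\mu$-symmetric for a probability measure $\mu$ on $E$, and generates a $\mu$-symmetric (hence stationary) semi-group $(P_t)_{t\ge0}$, which is a contraction semi-group on $L^p(\mu)$ for all $1\le p\le+\infty$, and for every $f\in L^2(\mu)$, $\|P_tf-\int f\,d\mu\|_{L^2(\mu)}\to0$ as $t\to+\infty$. The process is a diffusion: $\Gamma$ comes from a derivation, $\Gamma(fg,h)=f\,\Gamma(g,h)+g\,\Gamma(f,h)$, and the chain rule $L(\varphi(f))=\varphi'(f)\,Lf+\varphi''(f)\,\Gamma(f,f)$ holds for $\varphi$ of class $C^2$. Notation. $\|f\|_p^p=\int|f|^p\,d\mu$, $N_p(f)=\|f-\int f\,d\mu\|_p$, and $\mathrm{Var}_\mu(f)=\int f^2\,d\mu-\left(\int f\,d\mu\right)^2$. *)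

(* Defs.v *)
From HB Require Import structures.
From mathcomp Require Import all_boot all_order all_algebra.
From mathcomp Require Import all_classical all_reals all_analysis.

Set Implicit Arguments.
Unset Strict Implicit.
Unset Printing Implicit Defensive.
Import Order.TTheory GRing.Theory Num.Theory.
Import numFieldNormedType.Exports.

Local Open Scope classical_set_scope.
Local Open Scope ring_scope.

(* A Polish space is given by a complete separable metric: the metric is needed
   to speak of uniformly continuous functions.  A [completePseudoMetricType] may
   identify distinct points, hence the Hausdorff requirement. *)
Definition polish (R : realType) (E : completePseudoMetricType R) : Prop :=
  hausdorff_space E /\ exists2 S : set E, countable S & dense S.

Definition borel (E : ptopologicalType) := g_sigma_algebraType (@open E).

Section LpNorm.
Context {R : realType} {d : measure_display} {T : measurableType d}.

Definition Lp_norm (mu : {measure set T -> \bar R}) (p : \bar R) (f : T -> R) :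
  \bar R := ('N[mu]_p[EFin \o f])%E.

End LpNorm.

Section Semigroup.
Context {R : realType} {E : completePseudoMetricType R}.
Variables (mu : probability (borel E) R)
          (P : R -> R.-pker (borel E) ~> (borel E)).

(* (P_t f)(x) = E_x[f(X_t)].  For f in L^p(mu), p >= 1, and mu invariant, f is
   P_t(x, .)-integrable for mu-almost every x; on the exceptional null set the
   value is an irrelevant default. *)
Definition semigroup (t : R) (f : E -> R) : E -> R :=
  fun x => \int[P t x]_y f y.

Definition transition_function : Prop :=
  (forall x (A : set (borel E)), measurable A -> P 0 x A = dirac x A) /\
  (forall (s t : R) x (A : set (borel E)), 0 <= s -> 0 <= t -> measurable A ->
     P (s + t) x A = (\int[P s x]_y P t y A)%E).

(* g = A f for the infinitesimal generator A of (P_t) on L^2(mu) *)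
Definition L2_generator (f g : E -> R) : Prop :=
  [/\ f \in Lfun mu 2%:E, g \in Lfun mu 2%:E &
   Lp_norm mu 2%:E (fun x => (semigroup t f x - f x) / t - g x)
     @[t --> 0^'+] --> 0%E].

(* D is a core of the generator, which acts on D by L: D is dense in L^2(mu),
   and dense in the domain of the generator for the graph norm. *)
Definition L2_core (D : set (E -> R)) (L : (E -> R) -> E -> R) : Prop :=
  [/\ forall f, D f -> L2_generator f (L f),
      forall f, f \in Lfun mu 2%:E -> forall e : R, 0 < e ->
        exists2 h, D h & (Lp_norm mu 2%:E (fun x => (h x - f x)%R) < e%:E)%E &
      forall f g, L2_generator f g -> forall e : R, 0 < e ->
        exists2 h, D h &
          (Lp_norm mu 2%:E (fun x => (h x - f x)%R) < e%:E)%E /\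
          (Lp_norm mu 2%:E (fun x => (L h x - g x)%R) < e%:E)%E].

(* N_p, with value in [0, +oo] *)
Definition centered_norm (p : R) (f : E -> R) : \bar R :=
  Lp_norm mu p%:E (fun x => f x - \int[mu]_y f y).

Definition Var (f : E -> R) : R :=
  \int[mu]_x (f x ^+ 2) - (\int[mu]_x f x) ^+ 2.

Definition Lp_decay (p K lambda : R) : Prop :=
  forall f, f \in Lfun mu p%:E -> forall t : R, 0 <= t ->
    (centered_norm p (semigroup t f)
       <= (K * expR (- (lambda * t)))%:E * centered_norm p f)%E.

End Semigroup.

Section Martingale.
Context {R : realType} {dO : measure_display} {O : measurableType dO}.
Variables (Pr : probability O R) (F : R -> set (set O)).

Definition filtration : Prop :=
  (forall t : R, 0 <= t -> sigma_algebra setT (F t) /\ F t `<=` measurable) /\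
  (forall s t : R, 0 <= s -> s <= t -> F s `<=` F t).

Definition stopping_time (T : O -> \bar R) : Prop :=
  (forall w, (0 <= T w)%E) /\
  (forall t : R, 0 <= t -> F t [set w | (T w <= t%:E)%E]).

Definition martingale (M : R -> O -> R) : Prop :=
  [/\ forall t : R, 0 <= t ->
        forall B : set R, measurable B -> F t (M t @^-1` B),
      forall t : R, 0 <= t -> Pr.-integrable setT (EFin \o M t) &
      forall (s t : R) A, 0 <= s -> s <= t -> F s A ->
        \int[Pr]_(w in A) M t w = \int[Pr]_(w in A) M s w].

Definition stopped (M : R -> O -> R) (T : O -> \bar R) : R -> O -> R :=
  fun t w => M (fine (mine t%:E (T w))) w.

Definition local_martingale (M : R -> O -> R) : Prop :=
  exists T : nat -> O -> \bar R,
    [/\ forall n, stopping_time (T n),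
        forall n w, (T n w <= T n.+1 w)%E,
        {ae Pr, forall w, T n w @[n --> \oo] --> +oo%E} &
        forall n, martingale (stopped M (T n))].

End Martingale.

Section Process.
Context {R : realType} {E : completePseudoMetricType R}
        {dO : measure_display} {O : measurableType dO}.
Variables (mu : probability (borel E) R)
          (P : R -> R.-pker (borel E) ~> (borel E))
          (Pr : probability O R) (F : R -> set (set O))
          (X : R -> O -> borel E).

(* (X_t)_{t >= 0} is, under Pr, a Markov process for the filtration F with
   transition function P and initial law mu. *)
Record markov_process : Prop := {
  mp_filtration : filtration F ;
  mp_adapted : forall t : R, 0 <= t ->
    forall A : set (borel E), measurable A -> F t (X t @^-1` A) ;
  mp_measurable : measurable_fun
    (`[(0 : R), +oo[%classic `*` [set: O] : set (measurableTypeR R * O))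
    (fun z : measurableTypeR R * O => X z.1 z.2) ;
  mp_initial : forall A : set (borel E), measurable A ->
    Pr (X 0 @^-1` A) = mu A ;
  mp_markov : forall (s t : R) (B : set O) (A : set (borel E)),
    0 <= s -> 0 <= t -> F s B -> measurable A ->
    Pr (B `&` X (s + t) @^-1` A) = (\int[Pr]_(w in B) P t (X s w) A)%E }.

(* f belongs to the extended domain of the generator of (X_t), with image g *)
Definition extended_generator (f g : E -> R) : Prop :=
  [/\ measurable_fun [set: borel E] f,
      measurable_fun [set: borel E] g,
      {ae Pr, forall w, forall t : R, 0 <= t ->
         (@lebesgue_measure R).-integrable `[0, t]
           (fun s => (g (X s w))%:E)} &
      local_martingale Pr F (fun t w => f (X t w) - f (X 0 w)
        - \int[@lebesgue_measure R]_(s in `[0, t]) g (X s w))].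

End Process.

Section Diffusion.
Context {R : realType} {E : completePseudoMetricType R}.

Definition carre_du_champ (L : (E -> R) -> E -> R) (f g : E -> R) : E -> R :=
  fun x => 2^-1 * (L (f \* g) x - f x * L g x - g x * L f x).

Definition dirichlet (mu : probability (borel E) R)
    (L : (E -> R) -> E -> R) (f : E -> R) : R :=
  - \int[mu]_x (f x * L f x).

Definition function_algebra (D : set (E -> R)) : Prop :=
  [/\ forall c : R, D (cst c),
      forall f g, D f -> D g -> D (f \+ g) &
      forall f g, D f -> D g -> D (f \* g)].

Definition C2 (phi : R -> R) : Prop :=
  [/\ forall x, derivable phi x 1,
      forall x, derivable (phi^`())%classic x 1 &
      continuous (phi^`(2))%classic].

Context {dO : measure_display} {O : measurableType dO}.

(* Only the values of the generator L on the core D are used; outside D the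
   generator is described by the relation [extended_generator].  Identities
   between values of L hold mu-almost everywhere. *)
Record symmetric_diffusion (mu : probability (borel E) R)
    (P : R -> R.-pker (borel E) ~> (borel E))
    (Pr : probability O R) (F : R -> set (set O)) (X : R -> O -> borel E)
    (D : set (E -> R)) (L : (E -> R) -> E -> R) : Prop := {
  sd_polish : polish E ;
  sd_transition : transition_function P ;
  sd_process : markov_process mu P Pr F X ;
  sd_strong_continuity : forall f, f \in Lfun mu 2%:E ->
    Lp_norm mu 2%:E (fun x => semigroup P t f x - f x)
      @[t --> 0^'+] --> 0%E ;
  sd_unif_continuous : forall f, D f -> unif_continuous (f : E -> R^o) ;
  sd_algebra : function_algebra D ;
  sd_extended : forall f, D f -> extended_generator Pr F X f (L f) ;
  sd_core : L2_core mu P D L ;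
  sd_dirichlet : forall f, D f ->
    dirichlet mu L f = \int[mu]_x carre_du_champ L f f x ;
  sd_symmetric_L : forall f g, D f -> D g ->
    \int[mu]_x (f x * L g x) = \int[mu]_x (g x * L f x) ;
  sd_symmetric : forall (t : R) f g, 0 <= t ->
    f \in Lfun mu 2%:E -> g \in Lfun mu 2%:E ->
    \int[mu]_x (f x * semigroup P t g x) =
    \int[mu]_x (g x * semigroup P t f x) ;
  sd_contraction : forall (p : \bar R) (t : R) f, (1 <= p)%E -> 0 <= t ->
    f \in Lfun mu p ->
    semigroup P t f \in Lfun mu p /\
    (Lp_norm mu p (semigroup P t f) <= Lp_norm mu p f)%E ;
  sd_ergodic : forall f, f \in Lfun mu 2%:E ->
    Lp_norm mu 2%:E (fun x => semigroup P t f x - \int[mu]_y f y)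
      @[t --> +oo] --> 0%E ;
  sd_derivation : forall f g h, D f -> D g -> D h ->
    {ae mu, forall x, carre_du_champ L (f \* g) h x =
      f x * carre_du_champ L g h x + g x * carre_du_champ L f h x} ;
  sd_chain_rule : forall (phi : R -> R) f, C2 phi -> D f ->
    extended_generator Pr F X (phi \o f)
      (fun x => (phi^`())%classic (f x) * L f x +
                (phi^`(2))%classic (f x) * carre_du_champ L f f x) }.

Definition poincare (mu : probability (borel E) R) (D : set (E -> R))
    (L : (E -> R) -> E -> R) (C_P : R) : Prop :=
  forall f, D f -> Var mu f <= C_P * \int[mu]_x carre_du_champ L f f x.

End Diffusion.

(* Main.v *)
Require Import Defs.
From HB Require Import structures.
From mathcomp Require Import all_boot all_order all_algebra.
From mathcomp Require Import all_classical all_reals all_analysis.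
From mathcomp Require Import measurable_realfun ring lra.
Import Order.TTheory GRing.Theory Num.Theory.
Import numFieldNormedType.Exports.
Set Implicit Arguments.
Unset Strict Implicit.
Unset Printing Implicit Defensive.
Local Open Scope classical_set_scope.
Local Open Scope ring_scope.

(** Write r = exp (- 2 h / C_P) for a time step h, and E for the integral
    against mu. Poincare's inequality amounts to the decay of the variance,

      E |P_h g|^2 <= r E |g|^2 + (1 - r) (E g)^2                          (1)

    (lemmas [L2_decay], [var_decay]). It is obtained by explicit Euler steps:
    on the domain of the generator the difference quotients converge uniformly
    along an orbit, because the semi-group commutes with them and contracts
    L^2, and Poincare's inequality extends from the core to that domain.

    The L^p estimates for p > 2 use nothing more than (1) and the positivity of
    the semi-group. By Jensen's inequality |P_h f|^(q/2) <= P_h |f|^(q/2), so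
    (1) applied to |f|^(q/2) gives ([moment_step])

      E |P_h f|^q <= r E |f|^q + (1 - r) (E |f|^(q/2))^2.                 (2)

    For f of mean zero, (2) is iterated along the n steps of length t / n. The
    last term is controlled by the decay of the second moment: for q <= 4 by
    Lyapunov's inequality, and for q >= 4 by

      (E |f|^(q/2))^2 <= E |f|^2 E |f|^(q-2)

    and interpolation of q - 2 between 2 and q. The resulting recursions yield
    ([moment_decay_le4], [moment_decay_ge4])

      E |P_t f|^q <= 4 exp (- t / C_P) E |f|^q      for 2 <= q <= 4,
      E |P_t f|^q <= 4 exp (- 2 t / C_P) E |f|^q    for q >= 4.

    These are at least as strong as the announced bounds for q > 2, since
    4^(1/q) <= 4^(1-1/q) when q >= 2 and 4^(1/q) <= 4^(1-2/q) when q >= 4; for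
    q = 2 the decay of the variance is itself the announced bound.

    For 1 < p < 2, let q be the conjugate exponent, h of mean zero, F = P_t h
    and g = sgn(F) |F|^(p-1), whose mean is denoted by m. Then, by symmetry,

      E |F|^p = E (F g) = E (h P_t (g - m)) <= ||h||_p ||P_t (g - m)||_q.

    The triangle inequality would cost a factor 2^q on E |g - m|^q, too much to
    reach the constant 2. But the signed power of order q of g is F, which has
    mean zero, and the strong monotonicity
    |a - b|^q <= 2^(q-2) (a - b) (spow q a - spow q b) gives
    E |g - m|^q <= 2^(q-2) E |g|^q ([moment_centering]). The overall constant is
    then (4 * 2^(q-2))^(1/q) = 2. *)

(** * Real-valued integrals *)

Section RealIntegrals.
Context {R : realType} {d : measure_display} {T : measurableType d}.
Variable mu : {measure set T -> \bar R}.
Implicit Types (f g : T -> R) (p q : R).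

Local Notation integrable f := (mu.-integrable [set: T] (EFin \o f)).

Lemma measurable_norm_powR p f : measurable_fun setT f ->
  measurable_fun setT (fun x => `|f x| `^ p).
Proof.
move=> mf; apply: (@measurableT_comp _ _ _ _ _ _ (@powR R ^~ p)) => //.
exact: measurableT_comp.
Qed.

Lemma integrableZ (c : R) f : integrable f -> integrable (fun x => c * f x).
Proof. by move=> fi; have := integrableZl measurableT c fi; apply: eq_integrable. Qed.

Lemma integrableDr f g : integrable f -> integrable g ->
  integrable (fun x => f x + g x).
Proof. by move=> fi gi; have := integrableD measurableT fi gi; apply: eq_integrable. Qed.

Lemma integrable_measurable f : integrable f -> measurable_fun setT f.
Proof. by move=> /measurable_int/measurable_EFinP. Qed.

Lemma integrable_abs f : integrable f -> integrable (fun x => `|f x|).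
Proof. by move=> fi; have := integrable_abse fi; apply: eq_integrable. Qed.

Lemma le_integrable_fun f g : measurable_fun setT f ->
  (forall x, `|f x| <= g x) -> integrable g -> integrable f.
Proof.
move=> mf fg; apply: le_integrable => //; first exact/measurable_EFinP.
by move=> x _ /=; rewrite lee_fin (le_trans (fg x))// ler_norm.
Qed.

Lemma ae_mono (Q Q' : T -> Prop) : (forall x, Q x -> Q' x) ->
  {ae mu, forall x, Q x} -> {ae mu, forall x, Q' x}.
Proof. by move=> QQ'; apply: filterS. Qed.

Lemma ae_mono2 (Q1 Q2 Q' : T -> Prop) : (forall x, Q1 x -> Q2 x -> Q' x) ->
  {ae mu, forall x, Q1 x} -> {ae mu, forall x, Q2 x} -> {ae mu, forall x, Q' x}.
Proof. by move=> QQ'; apply: filterS2. Qed.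

Lemma ae_eq_Rintegral f g : measurable_fun setT f -> measurable_fun setT g ->
  {ae mu, forall x, f x = g x} -> \int[mu]_x f x = \int[mu]_x g x.
Proof.
move=> mf mg fg; congr fine; apply: ae_eq_integral => //;
  [exact/measurable_EFinP|exact/measurable_EFinP|].
by apply: filterS fg => x /= -> _.
Qed.

Lemma ae_le_Rintegral f g : integrable f -> integrable g ->
  {ae mu, forall x, f x <= g x} -> \int[mu]_x f x <= \int[mu]_x g x.
Proof.
move=> fi gi fg.
have mf := integrable_measurable fi; have mg := integrable_measurable gi.
have -> : \int[mu]_x g x = \int[mu]_x (Num.max (f x) (g x)).
  apply: ae_eq_Rintegral => //; first exact: measurable_maxr.
  by apply: filterS fg => x ?; rewrite max_r.
apply: le_Rintegral => //; last by move=> x _; rewrite le_max lexx.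
apply: (@le_integrable_fun _ (fun x => `|f x| + `|g x|)).
- exact: measurable_maxr.
- by move=> x; rewrite /Num.max; case: ifP => _; rewrite ?lerDl ?lerDr.
- by apply: integrableDr; exact: integrable_abs.
Qed.

Hypothesis mu1 : mu setT = 1%E.

Lemma integrable_cst (c : R) : integrable (cst c).
Proof.
apply/integrableP; split; first exact/measurable_EFinP/measurable_cst.
have /= h := integral_cst mu (@measurableT _ T) `|c|%:E.
by apply: (@le_lt_trans _ _ `|c|%:E); [rewrite -[leRHS]mule1 -mu1 -h|exact: ltry].
Qed.

Lemma Rintegral_cst1 (c : R) : \int[mu]_x c = c.
Proof. by rewrite Rintegral_cst// mu1 mulr1. Qed.

(** Jensen's inequality for powers, on a probability space. *)
Lemma jensen_powR r g : 1 <= r -> (forall x, 0 <= g x) -> integrable g ->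
  integrable (fun x => g x `^ r) ->
  (\int[mu]_x g x) `^ r <= \int[mu]_x (g x `^ r).
Proof.
rewrite le_eqVlt => /predU1P[<- g0 ig _|r1 g0 ig igr].
  rewrite powRr1; last by apply: Rintegral_ge0 => x _.
  by rewrite [leRHS](@eq_Rintegral _ _ _ _ _ g)// => x _; rewrite powRr1.
have r0 : 0 < r by rewrite (lt_trans ltr01).
set m := \int[mu]_x g x.
have m0 : 0 <= m by apply: Rintegral_ge0 => x _.
(* Young's inequality against the constant m ^ (r - 1). *)
pose r' := (1 - r^-1)^-1.
have ri1 : r^-1 < 1 by rewrite invf_lt1.
have r'0 : 0 < r' by rewrite invr_gt0 subr_gt0.
have rr' : r^-1 + r'^-1 = 1 by rewrite /r' invrK subrKC.
have mE : (m `^ (r - 1)) `^ r' = m `^ r.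
  rewrite -powRrM; congr (_ `^ _); rewrite /r'.
  have -> : 1 - r^-1 = (r - 1) / r by rewrite mulrBl mul1r divff ?gt_eqF.
  by rewrite invf_div mulrCA divff ?mulr1// subr_eq0 gt_eqF.
have : \int[mu]_x (m `^ (r - 1) * g x) <=
       \int[mu]_x (r^-1 * (g x `^ r) + m `^ r / r').
  apply: le_Rintegral => //.
  - exact: integrableZ.
  - by apply: integrableDr; [exact: integrableZ|exact: integrable_cst].
  - move=> x _; rewrite mulrC -mE [r^-1 * _]mulrC.
    by apply: conjugate_powR => //; exact: powR_ge0.
rewrite RintegralZl// RintegralD//; last 2 first.
- exact: integrableZ.
- exact: integrable_cst.
rewrite [X in _ <= _ + X]Rintegral_cst1 RintegralZl// mulrC mulr_powRB1//.
rewrite -lerBlDr -{1}[m `^ r]mulr1 -mulrBr.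
have -> : 1 - r'^-1 = r^-1 by rewrite -rr' addrK.
by rewrite mulrC ler_pM2l ?invr_gt0.
Qed.

End RealIntegrals.

(** * Moments on a probability space *)

(** The absolute moment of order p, a real number; it is the p-th power of the
    L^p norm when f is in L^p (lemma [Lp_norm_moment]). *)
HB.lock Definition moment {R : realType} {d : measure_display}
    {T : measurableType d} (mu : {measure set T -> \bar R}) (p : R) (f : T -> R)
  : R := \int[mu]_x (`|f x| `^ p).

Section Moments.
Context {R : realType} {d : measure_display} {T : measurableType d}.
Variable mu : probability T R.
Implicit Types (f g : T -> R) (p q : R).

Local Notation integrable f := (mu.-integrable [set: T] (EFin \o f)).

Lemma moment_ge0 p f : 0 <= moment mu p f.
Proof. by rewrite unlock; apply: Rintegral_ge0 => x _; exact: powR_ge0. Qed.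

Lemma LfunE p f : 1 <= p ->
  f \in Lfun mu p%:E <->
  measurable_fun setT f /\ integrable (fun x => `|f x| `^ p).
Proof.
move=> p1; have p0 : 0 < p by rewrite (lt_le_trans ltr01).
split=> [fp|[mf ifp]].
  split; last exact: Lfun_integrable.
  by move: fp; rewrite inE => /andP[/[!inE]].
rewrite inE; apply/andP; split; rewrite inE//= /finite_norm unlock poweR_lty//.
move/integrableP : ifp => [_]; apply: le_lt_trans.
by under [leRHS]eq_integral => x _ do rewrite /= ger0_norm ?powR_ge0//.
Qed.

Lemma Lfun_measurable (p : \bar R) f : f \in Lfun mu p -> measurable_fun setT f.
Proof. by rewrite inE => /andP[/[!inE]]. Qed.

Lemma Lp_norm_moment p f : 1 <= p -> f \in Lfun mu p%:E ->
  Lp_norm mu p%:E f = (moment mu p f `^ p^-1)%:E.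
Proof.
move=> p1 /(LfunE _ p1)[mf ifp].
rewrite /Lp_norm !unlock -poweR_EFin; congr poweR.
rewrite /Rintegral fineK//.
exact: (integrable_fin_num measurableT ifp).
Qed.

Lemma ae_eq_moment p f g : measurable_fun setT f -> measurable_fun setT g ->
  {ae mu, forall x, f x = g x} -> moment mu p f = moment mu p g.
Proof.
move=> mf mg fg; rewrite unlock; apply: ae_eq_Rintegral; try exact: measurable_norm_powR.
by apply: filterS fg => x ->.
Qed.

Lemma Lfun_addf p f g : 1 <= p -> f \in Lfun mu p%:E -> g \in Lfun mu p%:E ->
  (fun x => f x + g x) \in Lfun mu p%:E.
Proof.
move=> p1 fp gp; have p1' : (1 <= p%:E)%E by rewrite lee_fin.
by have [_ h] := Lfun_addr_closed mu p1'; exact: (h f g fp gp).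
Qed.

Lemma Lfun_scalef p c f : 1 <= p -> f \in Lfun mu p%:E ->
  (fun x => c * f x) \in Lfun mu p%:E.
Proof.
move=> p1 fp; rewrite (_ : (fun x => _) = c \o* f); first exact: Lfun_scale.
by apply/funext => x /=; rewrite mulrC.
Qed.

Lemma Lfun_subf p f g : 1 <= p -> f \in Lfun mu p%:E -> g \in Lfun mu p%:E ->
  (fun x => f x - g x) \in Lfun mu p%:E.
Proof.
move=> p1 fp gp; rewrite (_ : (fun x => _) = (fun x => f x + -1 * g x)).
  by apply: Lfun_addf => //; exact: Lfun_scalef.
by apply/funext => x; rewrite mulN1r.
Qed.

Lemma Lfun_cstf p (c : R) : (fun=> c) \in Lfun mu p%:E.
Proof. exact: Lfun_cst. Qed.

Lemma Lfun_le p q f : 1 <= p -> p <= q -> f \in Lfun mu q%:E -> f \in Lfun mu p%:E.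
Proof.
move=> p1 pq; apply: Lfun_subset; rewrite ?lee_fin ?(le_trans p1)//.
exact: fin_num_measure.
Qed.

Lemma Lfun_integrable1 p f : 1 <= p -> f \in Lfun mu p%:E -> integrable f.
Proof. by move=> p1 fp; apply/Lfun1_integrable; exact: Lfun_le fp. Qed.

Lemma Lfun_powR a s f : 1 <= a -> 1 <= s * a -> f \in Lfun mu (s * a)%:E ->
  (fun x => `|f x| `^ s) \in Lfun mu a%:E.
Proof.
move=> a1 sa1 /(LfunE _ sa1)[mf ifp]; apply/LfunE => //; split.
  exact: measurable_norm_powR.
move: ifp; apply: eq_integrable => // x _ /=.
by rewrite powRrM [in RHS]ger0_norm ?powR_ge0.
Qed.

Lemma moment_powR s a f : moment mu a (fun x => `|f x| `^ s) = moment mu (s * a) f.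
Proof.
by rewrite unlock; apply: eq_Rintegral => x _; rewrite powRrM ger0_norm ?powR_ge0.
Qed.

Lemma powR2 (x : R) : `|x| `^ 2 = x ^+ 2.
Proof. by rewrite powR_mulrn// real_normK// num_real. Qed.

Lemma moment2 f : moment mu 2 f = \int[mu]_x (f x ^+ 2).
Proof. by rewrite unlock; apply: eq_Rintegral => x _; rewrite powR2. Qed.

Lemma Lfun2_sqr f : f \in Lfun mu 2%:E -> integrable (fun x => f x ^+ 2).
Proof. exact: Lfun2_integrable_sqr. Qed.

Lemma Lfun2_mul f g : f \in Lfun mu 2%:E -> g \in Lfun mu 2%:E ->
  integrable (fun x => f x * g x).
Proof. by move=> f2 g2; apply/Lfun1_integrable; exact: Lfun2_mul_Lfun1. Qed.

(** Hoelder's inequality, together with the integrability of the product. *)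
Lemma holder_moment p q f g : 1 <= p -> 1 <= q -> p^-1 + q^-1 = 1 ->
  f \in Lfun mu p%:E -> g \in Lfun mu q%:E ->
  integrable (fun x => f x * g x) /\
  `|\int[mu]_x (f x * g x)| <= moment mu p f `^ p^-1 * moment mu q g `^ q^-1.
Proof.
move=> p1 q1 pq fp gq.
have mf := Lfun_measurable fp; have mg := Lfun_measurable gq.
have p0 : 0 < p by rewrite (lt_le_trans ltr01).
have q0 : 0 < q by rewrite (lt_le_trans ltr01).
have := hoelder mu mf mg p0 q0 pq.
have := Lp_norm_moment p1 fp; have := Lp_norm_moment q1 gq.
rewrite /Lp_norm => -> -> H.
have ifg : integrable (fun x => f x * g x).
  apply/integrableP; split; first exact/measurable_EFinP/measurable_funM.
  by move: H; rewrite Lnorm1 => /le_lt_trans; apply; rewrite -EFinM ltry.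
split=> //; rewrite -lee_fin EFinM; apply: le_trans H.
rewrite Lnorm1 EFin_normr_Rintegral//.
exact/(le_abse_integral _ measurableT)/measurable_EFinP/measurable_funM.
Qed.

(** Lyapunov's inequality between moments. *)
Lemma moment_mono a b f : 1 <= a -> a <= b -> f \in Lfun mu b%:E ->
  moment mu a f `^ (b / a) <= moment mu b f.
Proof.
move=> a1 ab fb; have a0 : 0 < a by rewrite (lt_le_trans ltr01).
have b1 := le_trans a1 ab.
have [mf ifb] := (LfunE _ b1).1 fb.
have [_ ifa] := (LfunE _ a1).1 (Lfun_le a1 ab fb).
have E x : `|f x| `^ b = (`|f x| `^ a) `^ (b / a).
  by rewrite -powRrM mulrC divfK ?gt_eqF.
have -> : moment mu b f = \int[mu]_x ((`|f x| `^ a) `^ (b / a)).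
  by rewrite unlock; apply: eq_Rintegral => x _; rewrite E.
rewrite unlock; apply: (jensen_powR (@probability_setT _ _ _ mu)) => //.
- by rewrite ler_pdivlMr ?mul1r.
- by move: ifb; apply: eq_integrable => // x _ /=; rewrite E.
Qed.

End Moments.

(** * Elementary inequalities *)

Section Elementary.
Context {R : realType}.
Implicit Types (a b c q r s x y : R).

Lemma powR_superadd s x y : 1 <= s -> 0 <= x -> 0 <= y ->
  x `^ s + y `^ s <= (x + y) `^ s.
Proof.
move=> s1 x0 y0; have s0 : 0 < s by rewrite (lt_le_trans ltr01).
rewrite -(mulr_powRB1 x0 s0) -(mulr_powRB1 y0 s0) -(mulr_powRB1 (addr_ge0 x0 y0) s0).
rewrite mulrDl.
by apply: lerD; apply: ler_wpM2l => //; apply: ge0_ler_powR;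
  rewrite ?subr_ge0 ?nnegrE ?addr_ge0// ?lerDl ?lerDr.
Qed.

Lemma powR_midconvex s x y : 1 <= s -> 0 <= x -> 0 <= y ->
  (x + y) `^ s <= 2 `^ (s - 1) * (x `^ s + y `^ s).
Proof.
rewrite le_eqVlt => /predU1P[<- x0 y0|s1 x0 y0].
  by rewrite subrr powRr0 mul1r !powRr1// addr_ge0.
have s0 : 0 < s by rewrite (lt_trans ltr01).
(* Young's inequality for each of x, y against ((x + y) / 2) ^ (s - 1). *)
pose s' := (1 - s^-1)^-1.
have si1 : s^-1 < 1 by rewrite invf_lt1.
have s'0 : 0 < s' by rewrite invr_gt0 subr_gt0.
have ss' : s^-1 + s'^-1 = 1 by rewrite /s' invrK subrKC.
set m := (x + y) / 2.
have m0 : 0 <= m by rewrite divr_ge0// addr_ge0.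
have mE : (m `^ (s - 1)) `^ s' = m `^ s.
  rewrite -powRrM; congr (_ `^ _); rewrite /s'.
  have -> : 1 - s^-1 = (s - 1) / s by rewrite mulrBl mul1r divff ?gt_eqF.
  by rewrite invf_div mulrCA divff ?mulr1// subr_eq0 gt_eqF.
have Y z : 0 <= z -> z * m `^ (s - 1) <= z `^ s / s + m `^ s / s'.
  by move=> z0; rewrite -mE; apply: conjugate_powR => //; exact: powR_ge0.
have mm : m * m `^ (s - 1) = m `^ s by rewrite mulr_powRB1.
have m2 : m `^ s <= (x `^ s + y `^ s) / 2.
  have /= := lerD (Y _ x0) (Y _ y0).
  rewrite -mulrDl (_ : x + y = 2 * m); last by rewrite /m mulrC divfK.
  rewrite -mulrA mm => H.
  have s'E : s'^-1 = 1 - s^-1 by rewrite -ss' addrAC subrr add0r.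
  rewrite s'E in H.
  have : s^-1 * (2 * m `^ s) <= s^-1 * (x `^ s + y `^ s) by lra.
  by rewrite ler_pM2l ?invr_gt0// mulrC -ler_pdivlMr.
have -> : (x + y) `^ s = 2 `^ s * m `^ s.
  by rewrite -powRM// /m mulrC divfK.
have -> : (2 : R) `^ s = 2 * 2 `^ (s - 1) by rewrite mulr_powRB1.
rewrite mulrC mulrA mulrC ler_wpM2l ?powR_ge0//.
by rewrite mulrC -ler_pdivlMl// mulrC.
Qed.

(** The signed power sgn(a) |a|^(s - 1): the derivative of |a|^s / s. *)
Definition spow s a : R := Num.sg a * `|a| `^ (s - 1).

Lemma spow_pos s a : 0 <= a -> 1 < s -> spow s a = a `^ (s - 1).
Proof.
rewrite /spow le_eqVlt => /predU1P[<-|a0] s1; last by rewrite gtr0_sg// mul1r gtr0_norm.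
by rewrite sgr0 mul0r powR0// subr_eq0 gt_eqF.
Qed.

Lemma spowN s a : spow s (- a) = - spow s a.
Proof. by rewrite /spow sgrN normrN mulNr. Qed.

Lemma mul_spow s a : 0 < s -> a * spow s a = `|a| `^ s.
Proof. by move=> s0; rewrite /spow mulrA [a * _]mulrC -normrEsg mulr_powRB1. Qed.

Lemma norm_spow s a : 1 < s -> `|spow s a| = `|a| `^ (s - 1).
Proof.
move=> s1; rewrite /spow normrM [X in _ * X]ger0_norm ?powR_ge0// normr_sg.
have [->|a0] := eqVneq a 0; last by rewrite mul1r.
by rewrite mul0r normr0 powR0// subr_eq0 gt_eqF.
Qed.

Lemma spow_conj p q a : 1 < p -> 1 < q -> (p - 1) * (q - 1) = 1 ->
  spow q (spow p a) = a.
Proof.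
move=> p1 q1 pq; rewrite {1}/spow norm_spow// -powRrM pq powRr1//.
rewrite /spow sgrM sgr_id; have [->|a0] := eqVneq a 0.
  by rewrite sgr0 !mul0r.
by rewrite [Num.sg (_ `^ _)]gtr0_sg ?powR_gt0 ?normr_gt0// mulr1 -numEsg.
Qed.

Lemma measurable_spow s : measurable_fun setT (spow s).
Proof.
apply: measurable_funM; last exact: measurable_norm_powR.
pose h a : R := (if 0 < a then 1 else if a < 0 then -1 else 0).
rewrite (_ : Num.sg = h); last first.
  apply/funext => a; rewrite /h; case: (ltgtP a 0) => [a0|a0|->].
  - by rewrite ltr0_sg.
  - by rewrite gtr0_sg.
  - by rewrite sgr0.
apply: measurable_fun_ifT => //; first exact: measurable_fun_ltr.
by apply: measurable_fun_ifT => //; exact: measurable_fun_ltr.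
Qed.

(** Strong monotonicity of the signed power, with a sharp constant
    (attained at b = - a). *)
Lemma spow_strong_mono q a b : 2 <= q ->
  `|a - b| `^ q <= 2 `^ (q - 2) * ((a - b) * (spow q a - spow q b)).
Proof.
move=> q2; have q1 : 1 < q by rewrite (lt_le_trans _ q2)// ltr1n.
have q0 : 0 < q by rewrite (lt_trans ltr01).
have qm1 : 1 <= q - 1 by lra.
have c1 : 1 <= 2 `^ (q - 2) :> R.
  by rewrite -[leLHS](powRr0 2); apply: ler_powR; rewrite ?ler1n// subr_ge0.
(* both arguments nonnegative and ordered: superadditivity *)
have same x y : 0 <= y -> y <= x ->
    `|x - y| `^ q <= 2 `^ (q - 2) * ((x - y) * (spow q x - spow q y)).
  move=> y0 yx; have x0 := le_trans y0 yx; have xy0 : 0 <= x - y by rewrite subr_ge0.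
  rewrite ger0_norm// !spow_pos// -mulr_powRB1//.
  have := powR_superadd qm1 xy0 y0; rewrite subrK => H.
  have H2 : (x - y) `^ (q - 1) <= x `^ (q - 1) - y `^ (q - 1) by rewrite lerBrDr.
  apply: (@le_trans _ _ (1 * ((x - y) * (x `^ (q - 1) - y `^ (q - 1))))).
    by rewrite mul1r ler_wpM2l.
  by rewrite ler_wpM2r// mulr_ge0// (le_trans _ H2)// powR_ge0.
(* arguments of opposite signs: convexity *)
have opp x y : 0 <= x -> y <= 0 ->
    `|x - y| `^ q <= 2 `^ (q - 2) * ((x - y) * (spow q x - spow q y)).
  move=> x0 y0; have y0' : 0 <= - y by rewrite oppr_ge0.
  have xy0 : 0 <= x - y by rewrite addr_ge0.
  rewrite ger0_norm// -spowN !spow_pos// -mulr_powRB1// mulrCA ler_wpM2l//.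
  have := powR_midconvex qm1 x0 y0'.
  by rewrite (_ : q - 1 - 1 = q - 2)//; lra.
have swap x y : `|x - y| `^ q <= 2 `^ (q - 2) * ((x - y) * (spow q x - spow q y)) ->
    `|y - x| `^ q <= 2 `^ (q - 2) * ((y - x) * (spow q y - spow q x)).
  by rewrite distrC; congr (_ <= _ * _); ring.
have neg x y : `|- x - - y| `^ q <=
      2 `^ (q - 2) * ((- x - - y) * (spow q (- x) - spow q (- y))) ->
    `|x - y| `^ q <= 2 `^ (q - 2) * ((x - y) * (spow q x - spow q y)).
  by rewrite !spowN opprK addrC distrC; congr (_ <= _ * _); ring.
have [a0|a0] := leP 0 a; have [b0|b0] := leP 0 b.
- by have [ba|/ltW ab] := leP b a; [exact: same|apply: swap; exact: same].
- by apply: opp => //; exact: ltW.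
- by apply: swap; apply: opp => //; exact: ltW.
- apply: neg; have [ab|/ltW ba] := leP a b.
    by apply: same; rewrite ?lerN2// oppr_ge0 ltW.
  by apply: swap; apply: same; rewrite ?lerN2// oppr_ge0 ltW.
Qed.

Lemma powR_concave_le x a : 0 <= x -> 0 <= a -> a < 1 -> x `^ a <= 1 - a + a * x.
Proof.
move=> x0; rewrite le_eqVlt => /predU1P[<- _|a0 a1].
  by rewrite powRr0 subr0 mul0r addr0.
have i0 : 0 < a^-1 by rewrite invr_gt0.
have j0 : 0 < (1 - a)^-1 by rewrite invr_gt0 subr_gt0.
have ij : a^-1^-1 + (1 - a)^-1^-1 = 1 by rewrite !invrK subrKC.
have := conjugate_powR (powR_ge0 x a) ler01 i0 j0 ij.
rewrite !invrK mulr1 -powRrM mulfV ?gt_eqF// powRr1// powR1 mul1r.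
by rewrite addrC mulrC.
Qed.

(** Homogeneous interpolation of the power q - 2 between the powers 2 and q. *)
Lemma powR_interp q x N (al := (q - 4) / (q - 2)) : 4 <= q -> 0 <= x -> 0 < N ->
  x `^ (q - 2) <= N `^ (q - 2) *
    ((1 - al) * (x ^+ 2 / N ^+ 2) + al * (x `^ q / N `^ q)).
Proof.
move=> q4 x0 N0.
have q20 : 0 < q - 2 by lra.
have al0 : 0 <= al by apply: divr_ge0; lra.
have al1 : al < 1 by rewrite ltr_pdivrMr// mul1r; lra.
have y0 : 0 <= x / N by rewrite divr_ge0// ltW.
have N0' := ltW N0.
have xN z : x `^ z / N `^ z = (x / N) `^ z.
  by rewrite powRM// ?invr_ge0// -[in RHS]powR_inv1// -powRrM mulN1r powRN.
have E z : x `^ z = N `^ z * (x / N) `^ z.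
  by rewrite -powRM// mulrC divfK// gt_eqF.
rewrite (E (q - 2)) ler_wpM2l ?powR_ge0// xN -expr_div_n -powR_mulrn//.
set y := x / N in y0 *.
have [->|yn0] := eqVneq y 0.
  by rewrite !powR0 ?mulr0 ?addr0//; lra.
have yp : 0 < y by rewrite lt_neqAle eq_sym yn0.
have H : (y `^ (q - 2)) `^ al = y `^ (q - 4).
  by rewrite -powRrM /al mulrCA divff ?gt_eqF// mulr1.
have -> : y `^ (q - 2) = y `^ 2 * (y `^ (q - 2)) `^ al.
  by rewrite H -powRD ?yn0 ?implybT//; congr (_ `^ _); lra.
have -> : (1 - al) * y `^ 2 + al * y `^ q =
    y `^ 2 * (1 - al + al * y `^ (q - 2)).
  rewrite mulrDr [y `^ 2 * (1 - al)]mulrC mulrCA -powRD ?yn0 ?implybT//.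
  by congr (_ + al * _ `^ _); lra.
by rewrite ler_wpM2l ?powR_ge0//; apply: powR_concave_le => //; exact: powR_ge0.
Qed.

Lemma expR_le_inv x : x < 1 -> expR x <= (1 - x)^-1.
Proof.
move=> x1; rewrite -[expR x]invrK lef_pV2 ?posrE ?subr_gt0 ?invr_gt0 ?expR_gt0//.
by rewrite -expRN; have := expR_ge1Dx (- x).
Qed.

(** Bounds the constant of [recursion_max], where 1 / r is at most 9 / 8. *)
Lemma expR98_le4 : expR (9 / 8) <= 4 :> R.
Proof.
have x0 := expR_ge0 (9 / 32 : R).
have x1 : expR (9 / 32) <= 32 / 23 :> R.
  apply: le_trans (expR_le_inv _) _; first lra.
  by rewrite le_eqVlt; apply/orP; left; apply/eqP; field.
have x2 : expR (9 / 32) * expR (9 / 32) <= 2 :> R by nra.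
have -> : expR (9 / 8) = (expR (9 / 32) * expR (9 / 32)) ^+ 2 :> R.
  by rewrite expr2 -!expRD; congr expR; lra.
by have := mulr_ge0 x0 x0; rewrite expr2; nra.
Qed.

(** A number of steps for which the decay over a single step is slight. *)
Lemma exists_steps x : 0 <= x ->
  exists2 n, (0 < n)%N & 8 / 9 <= expR (- (x / n%:R)).
Proof.
move=> x0; pose n := (Num.truncn (9 * x)).+1; exists n => //.
have n0 : 0 < n%:R :> R by rewrite ltr0n.
have H : 9 * x <= n%:R.
  by apply: ltW; apply: real_truncnS_gt; exact: num_real.
apply: le_trans (expR_ge1Dx _).
have : x / n%:R <= 1 / 9 by rewrite ler_pdivrMr//; lra.
lra.
Qed.

Lemma young_sqr e a b : 0 < e ->
  a * b <= (e / 2) * a ^+ 2 + (e^-1 / 2) * b ^+ 2.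
Proof.
move=> e0; rewrite -subr_ge0.
have -> : (e / 2) * a ^+ 2 + (e^-1 / 2) * b ^+ 2 - a * b =
    (e * a - b) ^+ 2 / (2 * e).
  by field; rewrite gt_eqF.
by rewrite divr_ge0 ?sqr_ge0// mulr_ge0// ltW.
Qed.

(** The arithmetic of letting d tend to 0 in the Poincare inequality for
    f + u and g + v, where u and v have L^2 norm at most d. Here F, G, U are the
    square norms of f, g, u; m is the squared mean of u; I, a, b, c, k are the
    inner products of (f, g), (u, v), (g, u), (f, v), (f, u). *)
Lemma perturbed_poincare (C d F G I a b c k U m : R) :
  0 < C -> 0 < d -> d <= 1 -> U <= d ^+ 2 -> m <= U ->
  - (d * (U + 1) / 2) <= a -> - (d * (G + 1) / 2) <= b ->
  - (d * (F + 1) / 2) <= c -> - (d * (F + 1) / 2) <= k ->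
  F + (2 * k + U) - m <= C * - (I + (c + (b + a))) ->
  F <= - C * I + d * (C * ((F + 1) / 2 + (G + 1) / 2 + 1) + (F + 1)).
Proof.
move=> C0 d0 d1 Ud mU ha hb hc hk H.
have U1 : U <= 1 by rewrite (le_trans Ud)// exprn_ile1// ltW.
have dU : d * (U + 1) / 2 <= d by rewrite -mulrA; apply: ler_piMr; [exact: ltW|lra].
have ha' : - d <= a by rewrite (le_trans _ ha)// lerN2.
have S : - (c + (b + a)) <= d * (F + 1) / 2 + d * (G + 1) / 2 + d.
  by rewrite !opprD addrA; apply: lerD; [apply: lerD|]; rewrite lerNl.
have CS := ler_wpM2l (ltW C0) S.
have -> : d * (C * ((F + 1) / 2 + (G + 1) / 2 + 1) + (F + 1)) =
  C * (d * (F + 1) / 2 + d * (G + 1) / 2 + d) + 2 * (d * (F + 1) / 2) by field.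
have E : C * - (I + (c + (b + a))) = - C * I + C * - (c + (b + a)) by ring.
rewrite E in H; set x := C * (_ + _ + d) in CS *.
set y := C * - _ in CS H; set z := - C * I in H *; set w := d * (F + 1) / 2 in hk *.
by move: x y z w CS H hk => x y z w *; lra.
Qed.

Lemma affine_recursion (u : nat -> R) r b : 0 <= r -> r <= 1 -> 0 <= b ->
  (forall n, u n.+1 <= r * u n + b) ->
  forall n, u n <= r ^+ n * u 0%N + n%:R * b.
Proof.
move=> r0 r1 b0 H; elim=> [|n IH]; first by rewrite expr0 mul1r mul0r addr0.
apply: (le_trans (H n)); rewrite exprS -natr1 mulrDl mul1r addrA lerD2r.
apply: (le_trans (ler_wpM2l r0 IH)); rewrite mulrDr mulrA lerD2l.
by rewrite ler_piMl// mulr_ge0.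
Qed.

(** The recursion satisfied by the moments of order at most 4 along the
    semi-group: a geometric forcing term of ratio s, damped at rate s ^+ 2. *)
Lemma recursion_sqrt (u v : nat -> R) s V : 1 / 3 <= s -> s <= 1 -> 0 <= V ->
  (forall n, u n.+1 <= s ^+ 2 * u n + (1 - s ^+ 2) * v n) ->
  (forall n, v n <= s ^+ n * V) -> u 0%N <= V ->
  forall n, u n <= 4 * s ^+ n * V.
Proof.
move=> s3 s1 V0 urec vV u0; have s0 : 0 <= s by lra.
elim=> [|n IH]; first by rewrite expr0; lra.
apply: le_trans (urec n) _.
have sn : 0 <= s ^+ n * V by rewrite mulr_ge0// exprn_ge0.
have h1 : s ^+ 2 * u n <= s ^+ 2 * (4 * s ^+ n * V) by rewrite ler_wpM2l// exprn_ge0.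
have h2 : (1 - s ^+ 2) * v n <= (1 - s ^+ 2) * (s ^+ n * V).
  by rewrite ler_wpM2l// subr_ge0 exprn_ile1.
have h3 : 0 <= (s ^+ n * V) * ((1 - s) * (3 * s - 1)).
  by rewrite mulr_ge0// mulr_ge0//; lra.
move: h1 h2 h3; rewrite (exprS s n).
have -> : 4 * (s * s ^+ n) * V = 4 * s * (s ^+ n * V) by ring.
have -> : 4 * s ^+ n * V = 4 * (s ^+ n * V) by ring.
move: (s ^+ n * V) => A; rewrite !expr2; lra.
Qed.

(** The recursion satisfied by the moments of order at least 4. The maximum
    of 1 and u n / (V * r ^+ n) grows at most by the factor
    1 + (1 - r) * r ^+ n / r at step n, and the product of these factors is
    below exp (1 / r). *)
Lemma recursion_max (u : nat -> R) r V : 8 / 9 <= r -> r <= 1 -> 0 <= V ->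
  (forall n, u n.+1 <= r * u n + (1 - r) * (r ^+ n * Num.max (V * r ^+ n) (u n))) ->
  u 0%N <= V -> forall n, u n <= 4 * r ^+ n * V.
Proof.
move=> r89 r1 V0 urec u0; have r0 : 0 < r by lra.
pose z n : R := expR ((1 - r ^+ n) / r).
have z1 n : 1 <= z n.
  by rewrite /z -[leLHS]expR0 ler_expR divr_ge0 ?subr_ge0 ?exprn_ile1// ltW.
have H n : u n <= V * r ^+ n * z n.
  elim: n => [|n IH]; first by rewrite /z expr0 subrr mul0r expR0 !mulr1.
  apply: le_trans (urec n) _.
  have rn : 0 <= r ^+ n by rewrite exprn_ge0// ltW.
  have Vr : 0 <= V * r ^+ n by rewrite mulr_ge0.
  have mx : Num.max (V * r ^+ n) (u n) <= V * r ^+ n * z n.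
    by rewrite ge_max IH andbT ler_peMr.
  have h1 : r * u n <= r * (V * r ^+ n * z n) by rewrite ler_wpM2l// ltW.
  have h2 : (1 - r) * (r ^+ n * Num.max (V * r ^+ n) (u n)) <=
            (1 - r) * (r ^+ n * (V * r ^+ n * z n)).
    by rewrite ler_wpM2l ?subr_ge0// ler_wpM2l.
  apply: (le_trans (lerD h1 h2)).
  have -> : z n.+1 = z n * expR ((r ^+ n - r ^+ n.+1) / r).
    by rewrite /z -expRD -mulrDl addrA subrK.
  have hz : 1 + (r ^+ n - r ^+ n.+1) / r <= expR ((r ^+ n - r ^+ n.+1) / r).
    exact: expR_ge1Dx.
  have hz' : r + (1 - r) * r ^+ n <= r * expR ((r ^+ n - r ^+ n.+1) / r).
    apply: le_trans (ler_wpM2l (ltW r0) hz).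
    rewrite le_eqVlt; apply/orP; left; apply/eqP.
    by rewrite exprS; field; rewrite gt_eqF.
  have := ler_wpM2l (mulr_ge0 Vr (le_trans ler01 (z1 n))) hz'.
  move: (expR _) => e; rewrite exprS; move: (r ^+ n) (z n) => a b; lra.
move=> n; apply: (le_trans (H n)).
have -> : 4 * r ^+ n * V = V * r ^+ n * 4 by ring.
apply: ler_wpM2l; first by rewrite mulr_ge0// exprn_ge0// ltW.
apply: le_trans expR98_le4; rewrite ler_expR ler_pdivrMr//.
have : 0 < r ^+ n by rewrite exprn_gt0.
lra.
Qed.

End Elementary.

(** * Real-valued norms *)

(** The L^p norm as a real number. *)
HB.lock Definition rnorm {R : realType} {d : measure_display}
    {T : measurableType d} (mu : {measure set T -> \bar R}) (p : R) (f : T -> R)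
  : R := moment mu p f `^ p^-1.

Section RealNorm.
Context {R : realType} {d : measure_display} {T : measurableType d}.
Variable mu : probability T R.
Implicit Types (f g : T -> R) (p q : R).

Lemma rnorm_ge0 p f : 0 <= rnorm mu p f.
Proof. by rewrite rnorm.unlock; exact: powR_ge0. Qed.

Lemma Lp_norm_rnorm p f : 1 <= p -> f \in Lfun mu p%:E ->
  Lp_norm mu p%:E f = (rnorm mu p f)%:E.
Proof. by rewrite rnorm.unlock; exact: Lp_norm_moment. Qed.

Lemma rnorm_powR p f : 1 <= p -> rnorm mu p f `^ p = moment mu p f.
Proof.
move=> p1; have p0 : 0 < p by rewrite (lt_le_trans ltr01).
by rewrite rnorm.unlock -powRrM mulVf ?gt_eqF// powRr1// moment_ge0.
Qed.

Lemma rnorm_le p (c : R) f g : 1 <= p -> 0 <= c ->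
  moment mu p f <= c * moment mu p g -> rnorm mu p f <= c `^ p^-1 * rnorm mu p g.
Proof.
move=> p1 c0 fg; have p0 : 0 < p by rewrite (lt_le_trans ltr01).
rewrite rnorm.unlock -powRM ?moment_ge0//; apply: ge0_ler_powR => //.
- by rewrite invr_ge0 ltW.
- by rewrite nnegrE moment_ge0.
- by rewrite nnegrE mulr_ge0 ?moment_ge0.
Qed.

Lemma rnormD p f g : 1 <= p -> f \in Lfun mu p%:E -> g \in Lfun mu p%:E ->
  rnorm mu p (fun x => f x + g x) <= rnorm mu p f + rnorm mu p g.
Proof.
move=> p1 fp gp; rewrite -lee_fin EFinD.
rewrite -(Lp_norm_rnorm p1 fp) -(Lp_norm_rnorm p1 gp).
rewrite -(Lp_norm_rnorm p1 (Lfun_addf p1 fp gp)).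
exact: (minkowski_EFin mu (Lfun_measurable fp) (Lfun_measurable gp) p1).
Qed.

Lemma ae_eq_rnorm p f g : measurable_fun setT f -> measurable_fun setT g ->
  {ae mu, forall x, f x = g x} -> rnorm mu p f = rnorm mu p g.
Proof. by move=> mf mg fg; rewrite rnorm.unlock (ae_eq_moment p mf mg fg). Qed.

Lemma rnormN p f : rnorm mu p (fun x => - f x) = rnorm mu p f.
Proof.
rewrite rnorm.unlock; have -> // : moment mu p (fun x => - f x) = moment mu p f.
by rewrite moment.unlock; apply: eq_Rintegral => x _; rewrite normrN.
Qed.

Lemma rnormBC p f g : rnorm mu p (fun x => f x - g x) = rnorm mu p (fun x => g x - f x).
Proof. by rewrite -rnormN; congr rnorm; apply/funext => x; rewrite opprB. Qed.

Lemma rnorm_cst p (c : R) : 1 <= p -> rnorm mu p (fun=> c) = `|c|.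
Proof.
move=> p1; have p0 : 0 < p by rewrite (lt_le_trans ltr01).
rewrite rnorm.unlock moment.unlock (Rintegral_cst1 (@probability_setT _ _ _ mu)).
by rewrite -powRrM mulfV ?gt_eqF// powRr1.
Qed.

Lemma moment1_le p f : 1 <= p -> f \in Lfun mu p%:E -> moment mu 1 f <= rnorm mu p f.
Proof.
move=> p1 fp; have p0 : 0 < p by rewrite (lt_le_trans ltr01).
rewrite rnorm.unlock; have := moment_mono (lexx 1) p1 fp; rewrite divr1 => h.
have -> : moment mu 1 f = (moment mu 1 f `^ p) `^ p^-1.
  by rewrite -powRrM mulfV ?gt_eqF// powRr1// moment_ge0.
by apply: ge0_ler_powR; rewrite ?nnegrE ?moment_ge0 ?powR_ge0// invr_ge0 ltW.
Qed.

Lemma norm_mean_le p f : 1 <= p -> f \in Lfun mu p%:E ->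
  `|\int[mu]_x f x| <= rnorm mu p f.
Proof.
move=> p1 fp; apply: le_trans (moment1_le p1 fp).
apply: (le_trans (le_normr_Rintegral measurableT (Lfun_integrable1 p1 fp))).
by rewrite moment.unlock; under [leRHS]eq_Rintegral do rewrite powRr1//.
Qed.

(** A function of small L^2 norm has small inner product with a fixed one. *)
Lemma small_dot (f u : T -> R) (e : R) : 0 < e -> f \in Lfun mu 2%:E ->
  u \in Lfun mu 2%:E -> moment mu 2 u <= e ^+ 2 ->
  `|\int[mu]_x (f x * u x)| <= e * (moment mu 2 f + 1) / 2.
Proof.
move=> e0 f2 u2 ue.
have fu := Lfun2_mul f2 u2.
have f2i := Lfun2_sqr f2; have u2i := Lfun2_sqr u2.
apply: (le_trans (le_normr_Rintegral measurableT fu)).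
have H : \int[mu]_x `|f x * u x| <=
    \int[mu]_x ((e / 2) * f x ^+ 2 + (e^-1 / 2) * u x ^+ 2).
  apply: le_Rintegral => //.
  - exact: (integrable_abs fu).
  - by apply: integrableDr; apply: integrableZ.
  - move=> x _.
    rewrite normrM -(powR2 (f x)) -(powR2 (u x)) !powR_mulrn//.
    exact: young_sqr.
apply: (le_trans H); rewrite RintegralD//; try exact: integrableZ.
rewrite !RintegralZl// -!moment2.
have : e^-1 * moment mu 2 u <= e by rewrite mulrC ler_pdivrMr// -expr2.
by rewrite [e^-1 / 2 * _]mulrAC; lra.
Qed.

End RealNorm.

(** * Integration against a composition of kernels *)

Section Bind.
Context {R : realType} {d0 d1 d2 : measure_display} {S : measurableType d0}
  {T : measurableType d1} {U : measurableType d2}.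
Variables (l : R.-sfker S ~> T) (k : R.-pker T ~> U) (s : S)
  (nu : {measure set U -> \bar R}).
(* nu is the mixture of the measures k x, with x distributed as l s *)
Hypothesis nuE : forall A, measurable A -> nu A = (\int[l s]_x k x A)%E.

Lemma ge0_integral_bind (f : U -> \bar R) : (forall y, 0 <= f y)%E ->
  measurable_fun setT f ->
  (\int[nu]_y f y = \int[l s]_x \int[k x]_y f y)%E.
Proof.
move=> f0 mf; rewrite -(@integral_kcomp _ _ _ _ _ _ R l
  (@kernel.kernel_snd _ _ _ S T U R k) s f f0 mf).
by apply: eq_measure_integral => A mA _; rewrite nuE.
Qed.

Lemma measurable_kernel_integral (f : U -> \bar R) : measurable_fun setT f ->
  measurable_fun setT (fun x => \int[k x]_y f y)%E.
Proof.
move=> mf; under eq_fun do rewrite integralE.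
apply: emeasurable_funB; apply: measurable_fun_integral_kernel => //.
- by move=> V mV; exact: measurable_kernel.
- exact: measurable_funepos.
- by move=> V mV; exact: measurable_kernel.
- exact: measurable_funeneg.
Qed.

(** Almost every measure of the family k integrates a function that the
    mixture of the family integrates. *)
Lemma ae_integrable_bind (f : U -> R) : nu.-integrable setT (EFin \o f) ->
  {ae l s, forall x, (k x).-integrable setT (EFin \o f)}.
Proof.
move=> /integrableP[mf fi].
have mabs : measurable_fun setT (fun x => \int[k x]_y `|(f y)%:E|)%E.
  apply: measurable_kernel_integral; exact: measurableT_comp.
have : (l s).-integrable setT (fun x => \int[k x]_y `|(f y)%:E|)%E.
  apply/integrableP; split=> //.
  under eq_integral do rewrite gee0_abs ?integral_ge0//.
  by rewrite -(ge0_integral_bind (f := fun y => `|(f y)%:E|%E))//;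
    exact: measurableT_comp.
move=> /(integrable_ae measurableT); apply: filterS => x /(_ I) fx.
by apply/integrableP; split => //; rewrite ltey_eq fx.
Qed.

Lemma Rintegral_bind (f : U -> R) : nu.-integrable setT (EFin \o f) ->
  \int[nu]_y f y = \int[l s]_x \int[k x]_y f y.
Proof.
move=> fi; have mf : measurable_fun setT (EFin \o f) by exact: measurable_int fi.
rewrite /Rintegral; congr fine.
have mK := measurable_kernel_integral mf.
have -> : (\int[l s]_x (fine (\int[k x]_y (f y)%:E))%:E =
           \int[l s]_x \int[k x]_y (f y)%:E)%E.
  apply: ae_eq_integral => //.
    by apply: measurableT_comp => //; apply: measurableT_comp.
  apply: filterS (ae_integrable_bind fi) => x fx _.
  by rewrite fineK//; exact: integrable_fin_num fx.
have mp := measurable_funepos mf; have mn := measurable_funeneg mf.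
rewrite integralE ge0_integral_bind// ge0_integral_bind//.
under [RHS]eq_integral do rewrite integralE.
have ip g : (forall y, 0 <= g y)%E -> nu.-integrable setT g ->
    (l s).-integrable setT (fun x => \int[k x]_y g y)%E.
  move=> g0 /integrableP[mg ig]; apply/integrableP; split.
    exact: measurable_kernel_integral.
  under eq_integral do rewrite gee0_abs ?integral_ge0//.
  rewrite -ge0_integral_bind//.
  by move: ig; under eq_integral do rewrite gee0_abs//.
by rewrite [RHS]integralB//; apply: ip => //;
  [exact: integrable_funepos|exact: integrable_funeneg].
Qed.

End Bind.

(** * Markov kernels with an invariant probability *)

Section InvariantKernel.
Context {R : realType} {d : measure_display} {T : measurableType d}.
Variables (mu : probability T R) (k : R.-pker T ~> T).
Hypothesis inv : forall A, measurable A -> mu A = (\int[mu]_x k x A)%E.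

Local Notation integrable m f := (m.-integrable [set: T] (EFin \o f)).

Let cmu := kprobability (measurable_cst (mu : pprobability T R) :
  measurable_fun [set: unit] _).

Lemma ae_integrable_kernel (f : T -> R) : integrable mu f ->
  {ae mu, forall x, integrable (k x) f}.
Proof. exact: (@ae_integrable_bind _ _ _ _ _ _ _ cmu k tt mu inv). Qed.

Lemma Rintegral_kernel (f : T -> R) : integrable mu f ->
  \int[mu]_x \int[k x]_y f y = \int[mu]_x f x.
Proof. by move=> fi; rewrite [RHS](@Rintegral_bind _ _ _ _ _ _ _ cmu k tt mu inv). Qed.

End InvariantKernel.

(** * Symmetric Markov semi-groups *)

Section SymmetricSemigroup.
Context {R : realType} {E : completePseudoMetricType R}.
Variables (mu : probability (borel E) R)
          (P : R -> R.-pker (borel E) ~> (borel E)).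

(** The part of the setting on which the L^p estimates rely once the L^2
    decay is known: a Markov transition function, symmetric on L^2(mu) and
    contracting every L^p(mu). *)
Record symmetric_semigroup : Prop := {
  ss_transition : transition_function P ;
  ss_symmetric : forall (t : R) f g, 0 <= t ->
    f \in Lfun mu 2%:E -> g \in Lfun mu 2%:E ->
    \int[mu]_x (f x * semigroup P t g x) =
    \int[mu]_x (g x * semigroup P t f x) ;
  ss_contraction : forall (p : \bar R) (t : R) f, (1 <= p)%E -> 0 <= t ->
    f \in Lfun mu p ->
    semigroup P t f \in Lfun mu p /\
    (Lp_norm mu p (semigroup P t f) <= Lp_norm mu p f)%E }.

Hypothesis ss : symmetric_semigroup.

Local Notation integrable f := (mu.-integrable [set: borel E] (EFin \o f)).
Implicit Types (f g : borel E -> R) (p s t : R).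

Lemma semigroup_cst t (c : R) : semigroup P t (fun=> c) = (fun=> c).
Proof.
apply/funext => x; rewrite /semigroup Rintegral_cst1//.
exact: prob_kernel.
Qed.

(** Symmetry against the constant 1 gives the invariance of mu. *)
Lemma semigroup_invariant t : 0 <= t ->
  forall A : set (borel E), measurable A -> mu A = (\int[mu]_x P t x A)%E.
Proof.
move=> t0 A mA.
have A2 : (\1_A : borel E -> R) \in Lfun mu 2%:E.
  apply/LfunE; first by rewrite ler1n.
  split; first exact: measurable_indic.
  apply: (@le_integrable_fun _ _ _ _ _ (fun=> 1)).
  - by apply: measurable_norm_powR; exact: measurable_indic.
  - move=> x; rewrite ger0_norm ?powR_ge0// powR2 indicE.
    by case: (x \in A); rewrite ?expr1n ?expr0n.
  - by apply: integrable_cst; exact: probability_setT.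
have := ss_symmetric ss t0 (Lfun_cstf mu 2 1) A2.
rewrite semigroup_cst.
under eq_Rintegral do rewrite mul1r.
under [in X in _ = X]eq_Rintegral do rewrite mulr1.
have PE x : semigroup P t \1_A x = fine (P t x A).
  by rewrite /semigroup /Rintegral integral_indic// setIT.
have Pt1 x : (P t x setT = 1)%E by exact: prob_kernel.
have Pfin x : (P t x A \is a fin_num)%E.
  rewrite ge0_fin_numE// (le_lt_trans _ (ltry 1))// -(Pt1 x).
  by apply: le_measure; rewrite ?inE.
under eq_Rintegral do rewrite PE.
rewrite /Rintegral integral_indic// setIT.
have -> : (\int[mu]_x (fine (P t x A))%:E = \int[mu]_x P t x A)%E.
  by apply: eq_integral => x _; rewrite fineK.
have PAfin : (\int[mu]_x P t x A \is a fin_num)%E.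
  rewrite ge0_fin_numE; last by apply: integral_ge0.
  apply: (@le_lt_trans _ _ (\int[mu]_x (cst 1 x))%E).
    apply: ge0_le_integral => //; first exact: measurable_kernel.
    move=> x _; rewrite -(Pt1 x).
    by apply: le_measure; rewrite ?inE.
  rewrite integral_cst// mul1e; apply: (@le_lt_trans _ _ 1%E); last exact: ltry.
  exact: probability_le1.
have mufin : (mu A \is a fin_num)%E by exact: fin_num_measure.
by move=> H; rewrite -(fineK PAfin) -(fineK mufin) H.
Qed.

Lemma semigroup_mean t f : 0 <= t -> integrable f ->
  \int[mu]_x semigroup P t f x = \int[mu]_x f x.
Proof. by move=> t0; exact: (Rintegral_kernel (semigroup_invariant t0)). Qed.

Lemma semigroup_Lfun p t f : 1 <= p -> 0 <= t -> f \in Lfun mu p%:E ->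
  semigroup P t f \in Lfun mu p%:E.
Proof. by move=> p1 t0 fp; have [] := ss_contraction ss (p := p%:E) p1 t0 fp. Qed.

Lemma semigroup_rnorm p t f : 1 <= p -> 0 <= t -> f \in Lfun mu p%:E ->
  rnorm mu p (semigroup P t f) <= rnorm mu p f.
Proof.
move=> p1 t0 fp; have [gp] := ss_contraction ss (p := p%:E) p1 t0 fp.
by rewrite (Lp_norm_rnorm p1 fp) (Lp_norm_rnorm p1 gp) lee_fin.
Qed.

Lemma semigroup_moment p t f : 1 <= p -> 0 <= t -> f \in Lfun mu p%:E ->
  moment mu p (semigroup P t f) <= moment mu p f.
Proof.
move=> p1 t0 fp; have p0 : 0 < p by rewrite (lt_le_trans ltr01).
have H := semigroup_rnorm p1 t0 fp.
rewrite -(rnorm_powR mu f p1) -(rnorm_powR mu (semigroup P t f) p1).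
by apply: ge0_ler_powR; rewrite ?nnegrE ?rnorm_ge0// ltW.
Qed.

Lemma semigroupD s t f : 0 <= s -> 0 <= t -> integrable f ->
  {ae mu, forall x, semigroup P (s + t) f x = semigroup P s (semigroup P t f) x}.
Proof.
move=> s0 t0 fi.
apply: filterS (ae_integrable_kernel (semigroup_invariant (addr_ge0 s0 t0)) fi) => x fx.
apply: (@Rintegral_bind _ _ _ _ _ _ _ (P s) (P t) x (P (s + t) x)) => //.
by move=> A mA; exact: (ss_transition ss).2.
Qed.

Lemma ae_semigroup_add t f g : 0 <= t -> integrable f -> integrable g ->
  {ae mu, forall x, semigroup P t (fun y => f y + g y) x =
                    semigroup P t f x + semigroup P t g x}.
Proof.
move=> t0 fi gi; apply: filterS2 (ae_integrable_kernel (semigroup_invariant t0) fi)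
  (ae_integrable_kernel (semigroup_invariant t0) gi) => x fx gx.
by rewrite /semigroup RintegralD.
Qed.

Lemma ae_semigroup_scale t (c : R) f : 0 <= t -> integrable f ->
  {ae mu, forall x, semigroup P t (fun y => c * f y) x = c * semigroup P t f x}.
Proof.
move=> t0 fi; apply: filterS (ae_integrable_kernel (semigroup_invariant t0) fi) => x fx.
by rewrite /semigroup RintegralZl.
Qed.

Lemma ae_semigroup_sub t f g : 0 <= t -> integrable f -> integrable g ->
  {ae mu, forall x, semigroup P t (fun y => f y - g y) x =
                    semigroup P t f x - semigroup P t g x}.
Proof.
move=> t0 fi gi; apply: filterS2 (ae_integrable_kernel (semigroup_invariant t0) fi)
  (ae_integrable_kernel (semigroup_invariant t0) gi) => x fx gx.
by rewrite /semigroup RintegralB.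
Qed.

(** Jensen's inequality for the transition kernel. *)
Lemma norm_semigroup_powR t s f x : 1 <= s ->
  (P t x).-integrable setT (EFin \o f) ->
  (P t x).-integrable setT (EFin \o (fun y => `|f y| `^ s)) ->
  `|semigroup P t f x| `^ s <= semigroup P t (fun y => `|f y| `^ s) x.
Proof.
move=> s1 fi fsi; have s0 : 0 <= s by rewrite (le_trans ler01).
apply: (le_trans _ (jensen_powR _ s1 _ (integrable_abs fi) fsi)) => //.
  apply: ge0_ler_powR => //; rewrite ?nnegrE//.
    by apply: Rintegral_ge0.
  exact: (le_normr_Rintegral measurableT fi).
exact: prob_kernel.
Qed.

(** The decay on the mean-zero part of L^p follows from the decay on the
    mean-zero part of a dense set stable under subtraction of constants. *)
Lemma rnorm_decay_dense p t (c : R) (S : set (E -> R)) : 1 <= p -> 0 <= t -> 0 <= c ->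
  (forall h, S h -> h \in Lfun mu p%:E) ->
  (forall h (a : R), S h -> S (fun x => h x - a)) ->
  (forall f, f \in Lfun mu p%:E -> forall e : R, 0 < e ->
     exists2 h, S h & rnorm mu p (fun x => h x - f x) < e) ->
  (forall h, S h -> \int[mu]_x h x = 0 ->
     rnorm mu p (semigroup P t h) <= c * rnorm mu p h) ->
  forall f, f \in Lfun mu p%:E -> \int[mu]_x f x = 0 ->
     rnorm mu p (semigroup P t f) <= c * rnorm mu p f.
Proof.
move=> p1 t0 c0 Sp Sc dense decay f fp f0.
have fi := Lfun_integrable1 p1 fp.
apply/ler_addgt0Pr => e e0.
pose d := e / (2 * (c + 1)).
have c10 : 0 < 2 * (c + 1) by rewrite mulr_gt0// ltr_wpDl.
have d0 : 0 < d by rewrite divr_gt0.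
have [h1 Sh1 h1d] := dense f fp d d0.
have h1p := Sp _ Sh1; have h1i := Lfun_integrable1 p1 h1p.
pose h x := h1 x - \int[mu]_x h1 x.
have Sh : S h by exact: Sc.
have hp := Sp _ Sh; have hi := Lfun_integrable1 p1 hp.
have mu1 : mu setT = 1%E by exact: probability_setT.
have h0 : \int[mu]_x h x = 0.
  rewrite RintegralB//; last exact: integrable_cst.
  by rewrite (Rintegral_cst1 mu1) subrr.
have dp := Lfun_subf p1 h1p fp.
(* centring costs at most one more copy of the distance *)
have hf : rnorm mu p (fun x => h x - f x) <= 2 * d.
  have -> : (fun x => h x - f x) =
      (fun x => (h1 x - f x) + - (\int[mu]_x h1 x)).
    by apply/funext => x; rewrite /h addrAC.
  apply: (le_trans (rnormD p1 dp (Lfun_cstf mu p _))).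
  rewrite rnorm_cst// normrN mulrDl mul1r; apply: lerD; first exact: ltW.
  have -> : \int[mu]_x h1 x = \int[mu]_x (h1 x - f x).
    by rewrite RintegralB// f0 subr0.
  exact: le_trans (norm_mean_le p1 dp) (ltW h1d).
have fh : rnorm mu p (fun x => f x - h x) <= 2 * d by rewrite rnormBC.
have fhp := Lfun_subf p1 fp hp; have fhi := Lfun_integrable1 p1 fhp.
have Pp g : g \in Lfun mu p%:E -> semigroup P t g \in Lfun mu p%:E.
  exact: semigroup_Lfun.
have Peq : rnorm mu p (semigroup P t f) =
    rnorm mu p (fun x => semigroup P t h x + semigroup P t (fun y => f y - h y) x).
  apply: ae_eq_rnorm.
  - exact: Lfun_measurable (Pp _ fp).
  - by apply: measurable_funD; [exact: Lfun_measurable (Pp _ hp)|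
      exact: Lfun_measurable (Pp _ fhp)].
  apply: ae_mono (ae_semigroup_add t0 hi fhi) => x <-.
  by congr (semigroup P t _ x); apply/funext => y; rewrite addrC subrK.
rewrite Peq; apply: (le_trans (rnormD p1 (Pp _ hp) (Pp _ fhp))).
have H1 := decay h Sh h0.
have H2 := semigroup_rnorm p1 t0 fhp.
have H3 : rnorm mu p h <= rnorm mu p f + rnorm mu p (fun x => h x - f x).
  rewrite [X in rnorm mu p X <= _](_ : h = (fun x => f x + (h x - f x))); last first.
    by apply/funext => x; rewrite addrC subrK.
  by apply: rnormD => //; exact: Lfun_subf.
have H4 : c * rnorm mu p h <= c * (rnorm mu p f + 2 * d).
  by rewrite ler_wpM2l// (le_trans H3)// lerD2l.
have H5 : 2 * (c + 1) * d = e by rewrite /d mulrC divfK// gt_eqF.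
apply: (le_trans (lerD (le_trans H1 H4) (le_trans H2 fh))).
by rewrite -H5; lra.
Qed.

(** Centring reduces the decay of N_p to functions of mean zero. *)
Lemma centered_decay p (K l : R) : 1 <= p ->
  (forall t f, 0 <= t -> f \in Lfun mu p%:E -> \int[mu]_x f x = 0 ->
     rnorm mu p (semigroup P t f) <= K * expR (- (l * t)) * rnorm mu p f) ->
  Lp_decay mu P p K l.
Proof.
move=> p1 H f fp t t0; have fi := Lfun_integrable1 p1 fp.
have mu1 : mu setT = 1%E by exact: probability_setT.
set m := \int[mu]_x f x.
have Pfp := semigroup_Lfun p1 t0 fp.
have cp : (fun=> m) \in Lfun mu p%:E by exact: Lfun_cstf.
have gp := Lfun_subf p1 fp cp.
have ci : integrable (fun=> m) by exact: integrable_cst.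
rewrite /centered_norm (semigroup_mean t0 fi) -/m.
rewrite (Lp_norm_rnorm p1 gp) (Lp_norm_rnorm p1 (Lfun_subf p1 Pfp cp)).
rewrite -EFinM lee_fin.
apply: le_trans (H t _ t0 gp _); last first.
  by rewrite RintegralB// (Rintegral_cst1 mu1) subrr.
have Pgp := semigroup_Lfun p1 t0 gp.
rewrite le_eqVlt; apply/orP; left; apply/eqP; apply: ae_eq_rnorm.
- exact: Lfun_measurable (Lfun_subf p1 Pfp cp).
- exact: Lfun_measurable Pgp.
- by apply: ae_mono (ae_semigroup_sub t0 fi ci) => x ->; rewrite semigroup_cst.
Qed.

End SymmetricSemigroup.

(** * From the Poincare inequality to the decay of the variance *)

Section L2Decay.
Context {R : realType} {E : completePseudoMetricType R}.
Variables (mu : probability (borel E) R)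
          (P : R -> R.-pker (borel E) ~> (borel E))
          (D : set (E -> R)) (L : (E -> R) -> E -> R) (C : R).
Hypotheses (ss : symmetric_semigroup mu P) (C0 : 0 < C)
  (core : L2_core mu P D L) (alg : function_algebra D)
  (poin : forall f, D f -> Var mu f <= C * dirichlet mu L f).

Local Notation integrable f := (mu.-integrable [set: borel E] (EFin \o f)).
Implicit Types (f g : borel E -> R) (p s t : R).

Let le12 : 1 <= 2 :> R. Proof. by rewrite ler1n. Qed.

Lemma rnorm2_lt f e : 0 < e -> rnorm mu 2 f <= e -> moment mu 2 f <= e ^+ 2.
Proof.
move=> e0 fe; rewrite -(rnorm_powR mu f le12) powR_mulrn ?rnorm_ge0//.
by apply: lerXn2r; rewrite ?nnegrE ?rnorm_ge0// ltW.
Qed.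

Lemma Lp_norm_lt f e : f \in Lfun mu 2%:E -> (Lp_norm mu 2%:E f < e%:E)%E ->
  rnorm mu 2 f < e.
Proof. by move=> f2; rewrite (Lp_norm_rnorm le12 f2) lte_fin. Qed.

(** The Poincare inequality passes from the core to the domain of the
    generator. *)
Lemma poincare_generator f g : L2_generator mu P f g -> \int[mu]_x f x = 0 ->
  moment mu 2 f <= - C * \int[mu]_x (f x * g x).
Proof.
move=> fg f0; have [f2 g2 _] := fg; have [Dgen _ dense] := core.
set F := moment mu 2 f; set G := moment mu 2 g.
have F0 : 0 <= F by exact: moment_ge0.
have G0 : 0 <= G by exact: moment_ge0.
apply/ler_addgt0Pr => e e0.
pose M := C * ((F + 1) / 2 + (G + 1) / 2 + 1) + (F + 1).
have M0 : 0 < M by rewrite ltr_wpDl ?mulr_ge0 ?ltW//; lra.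
pose d := e / (M + e).
have Me0 : 0 < M + e by rewrite addr_gt0.
have d0 : 0 < d by rewrite divr_gt0.
have d1 : d <= 1 by rewrite ler_pdivrMr// mul1r lerDr ltW.
have dM : d * M <= e.
  by rewrite /d mulrAC ler_pdivrMr// ler_wpM2l ?ltW// ltrDl.
have [h Dh [hf Lhg]] := dense f g fg d d0.
have [h2 Lh2 _] := Dgen h Dh.
pose u x := h x - f x; pose v x := L h x - g x.
have u2 : (u : borel E -> R) \in Lfun mu 2%:E by exact: Lfun_subf.
have v2 : (v : borel E -> R) \in Lfun mu 2%:E by exact: Lfun_subf.
have mu2 := rnorm2_lt d0 (ltW (Lp_norm_lt u2 hf)).
have mv2 := rnorm2_lt d0 (ltW (Lp_norm_lt v2 Lhg)).
have mu1 : mu setT = 1%E by exact: probability_setT.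
have fi := Lfun_integrable1 le12 f2; have ui := Lfun_integrable1 le12 u2.
(* h = f + u and L h = g + v with u, v small in L^2 *)
have hE x : h x = f x + u x by rewrite /u addrC subrK.
have LhE x : L h x = g x + v x by rewrite /v addrC subrK.
have hh : \int[mu]_x (h x ^+ 2) =
    F + (2 * \int[mu]_x (f x * u x) + moment mu 2 u).
  rewrite /F !moment2.
  rewrite -RintegralZl//; last exact: Lfun2_mul.
  rewrite -RintegralD//; last 2 first.
  - by apply: integrableZ; exact: Lfun2_mul.
  - exact: Lfun2_sqr.
  rewrite -RintegralD//; last 2 first.
  - exact: Lfun2_sqr.
  - by apply: integrableDr; [apply: integrableZ; exact: Lfun2_mul|exact: Lfun2_sqr].
  by apply: eq_Rintegral => x _; rewrite hE; ring.
have hm : \int[mu]_x h x = \int[mu]_x u x.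
  under eq_Rintegral do rewrite hE.
  by rewrite RintegralD// f0 add0r.
have hLh : \int[mu]_x (h x * L h x) = \int[mu]_x (f x * g x) +
    (\int[mu]_x (f x * v x) + (\int[mu]_x (g x * u x) + \int[mu]_x (u x * v x))).
  rewrite -RintegralD//; try exact: Lfun2_mul.
  rewrite -RintegralD//; try exact: Lfun2_mul; last first.
    by apply: integrableDr; exact: Lfun2_mul.
  rewrite -RintegralD//; try exact: Lfun2_mul; last first.
    by apply: integrableDr; [|apply: integrableDr]; exact: Lfun2_mul.
  by apply: eq_Rintegral => x _; rewrite hE LhE; ring.
have := poin Dh; rewrite /Var /dirichlet hh hm hLh.
have um : (\int[mu]_x u x) ^+ 2 <= moment mu 2 u.
  rewrite -(rnorm_powR mu u le12) powR_mulrn ?rnorm_ge0//.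
  rewrite -(real_normK (num_real (\int[mu]_x u x))).
  by apply: lerXn2r; rewrite ?nnegrE ?rnorm_ge0//; exact: norm_mean_le.
have lo x y : `|x| <= y -> - y <= x :> R by rewrite ler_norml => /andP[].
move=> H; apply: (le_trans (perturbed_poincare C0 d0 d1 mu2 um
  (lo _ _ (small_dot d0 u2 v2 mv2)) (lo _ _ (small_dot d0 g2 u2 mu2))
  (lo _ _ (small_dot d0 f2 v2 mv2)) (lo _ _ (small_dot d0 f2 u2 mu2)) H)).
by rewrite lerD2l.
Qed.

Lemma quotient_Lfun f g h t : f \in Lfun mu 2%:E -> g \in Lfun mu 2%:E ->
  h \in Lfun mu 2%:E -> (fun x => (f x - g x) / t - h x) \in Lfun mu 2%:E.
Proof.
move=> f2 g2 h2; apply: Lfun_subf => //.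
rewrite (_ : (fun x => _) = (fun x => t^-1 * (f x - g x))).
  by apply: Lfun_scalef => //; exact: Lfun_subf.
by apply/funext => x; rewrite mulrC.
Qed.

(** The semi-group commutes with its difference quotients, so the convergence
    of the latter is uniform along an orbit. *)
Lemma generator_quotient f g s t : f \in Lfun mu 2%:E -> g \in Lfun mu 2%:E ->
  0 <= s -> 0 <= t ->
  (fun x => (semigroup P t (semigroup P s f) x - semigroup P s f x) / t
            - semigroup P s g x) \in Lfun mu 2%:E /\
  rnorm mu 2 (fun x => (semigroup P t (semigroup P s f) x - semigroup P s f x) / t
            - semigroup P s g x) <=
  rnorm mu 2 (fun x => (semigroup P t f x - f x) / t - g x).
Proof.
move=> f2 g2 s0 t0.
have S r h : 0 <= r -> h \in Lfun mu 2%:E -> semigroup P r h \in Lfun mu 2%:E.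
  by move=> r0; exact: semigroup_Lfun.
have Qf := quotient_Lfun t (S t f t0 f2) f2 g2.
have Qs := quotient_Lfun t (S t _ t0 (S s f s0 f2)) (S s f s0 f2) (S s g s0 g2).
split => //; apply: le_trans (semigroup_rnorm ss le12 s0 Qf).
rewrite le_eqVlt; apply/orP; left; apply/eqP; apply: ae_eq_rnorm.
- exact: Lfun_measurable Qs.
- exact: Lfun_measurable (S _ _ s0 Qf).
have fi := Lfun_integrable1 le12 f2; have gi := Lfun_integrable1 le12 g2.
have Pfi := Lfun_integrable1 le12 (S t f t0 f2).
have df := Lfun_subf le12 (S t f t0 f2) f2.
have dfi := Lfun_integrable1 le12 df.
have tdfi : integrable (fun x => t^-1 * (semigroup P t f x - f x)).
  exact: integrableZ.
have e1 := semigroupD ss t0 s0 fi.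
have e2 := semigroupD ss s0 t0 fi.
have e3 := ae_semigroup_sub ss s0 tdfi gi.
have e4 := ae_semigroup_scale ss t^-1 s0 dfi.
have e5 := ae_semigroup_sub ss s0 Pfi fi.
have e12 := ae_mono2 (fun x (a : _ = _) (b : _ = _) => conj a b) e1 e2.
have e34 := ae_mono2 (fun x (a : _ = _) (b : _ = _) => conj a b) e3 e4.
apply: ae_mono2 (ae_mono2 (fun x a b => conj a b) e12 e34) e5.
move=> x [[h1 h2] [h3 h4]] h5.
have -> : (fun x => (semigroup P t f x - f x) / t - g x) =
    (fun x => t^-1 * (semigroup P t f x - f x) - g x).
  by apply/funext => y; rewrite mulrC.
by rewrite h3 h4 h5 -h1 -h2 [s + t]addrC mulrC.
Qed.

Lemma generator_near f g : L2_generator mu P f g -> forall e, 0 < e ->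
  exists2 d, 0 < d & forall t, 0 < t -> t < d ->
    rnorm mu 2 (fun x => (semigroup P t f x - f x) / t - g x) < e.
Proof.
move=> [f2 g2 fg] e e0.
have U : nbhs (0%E : \bar R) [set y : \bar R | (y < e%:E)%E].
  by apply: open_nbhs_nbhs; split; [exact: open_ereal_lt_ereal|rewrite /= lte_fin].
have /nbhs_ballP[d /= d0 H] := fg _ U.
exists d => // t t0 td.
have := H t; rewrite /ball /= sub0r normrN gtr0_norm// => /(_ td t0) /=.
apply: Lp_norm_lt.
exact: quotient_Lfun (semigroup_Lfun ss le12 (ltW t0) f2) f2 g2.
Qed.

Lemma generator_semigroup f g s : 0 <= s -> L2_generator mu P f g ->
  L2_generator mu P (semigroup P s f) (semigroup P s g).
Proof.
move=> s0 fg; have [f2 g2 lim] := fg; split; try exact: semigroup_Lfun.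
apply: (squeeze_cvge _ (cvg_cst 0%E) lim).
near=> t; have t0 : 0 <= t by [].
have [Qs2 Qle] := generator_quotient f2 g2 s0 t0.
apply/andP; split; first exact: Lnorm_ge0.
rewrite (Lp_norm_rnorm le12 Qs2).
have Qf2 := quotient_Lfun t (semigroup_Lfun ss le12 t0 f2) f2 g2.
by rewrite (Lp_norm_rnorm le12 Qf2) lee_fin.
Unshelve. all: by end_near. Qed.

(** One explicit Euler step: e bounds the error of the difference quotient,
    F and G bound the square norms of g and k, and k stands for the image of g
    by the generator. *)
Lemma euler_step g k (h e F G : R) : 0 < h -> 0 < e ->
  g \in Lfun mu 2%:E -> k \in Lfun mu 2%:E ->
  moment mu 2 g <= - C * \int[mu]_x (g x * k x) ->
  rnorm mu 2 (fun x => (semigroup P h g x - g x) / h - k x) <= e ->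
  moment mu 2 g <= F -> moment mu 2 k <= G ->
  moment mu 2 (semigroup P h g) <= expR (- (2 * h / C)) * moment mu 2 g +
    h * (e * (F + 1) + h * (2 * G + 2 * e ^+ 2)).
Proof.
move=> h0 e0 g2 k2 pk qe gF kG.
have Pg2 := semigroup_Lfun ss le12 (ltW h0) g2.
pose v x := (semigroup P h g x - g x) / h - k x.
have v2 : v \in Lfun mu 2%:E by exact: quotient_Lfun.
have mv := rnorm2_lt e0 qe; rewrite -/v in mv.
have PE x : semigroup P h g x = g x + h * (k x + v x).
  by rewrite /v addrC [k x + _]addrC subrK mulrC divfK ?subrK// gt_eqF.
have gv := small_dot e0 g2 v2 mv.
have i1 := Lfun2_sqr g2; have i2 := Lfun2_mul g2 k2; have i3 := Lfun2_mul g2 v2.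
have i4 := Lfun2_sqr k2; have i5 := Lfun2_sqr v2.
have z (a : R) u : integrable u -> integrable (fun x => a * u x) by exact: integrableZ.
have H : moment mu 2 (semigroup P h g) <= \int[mu]_x (g x ^+ 2 +
    ((2 * h) * (g x * k x) + ((2 * h) * (g x * v x) +
    ((2 * h ^+ 2) * k x ^+ 2 + (2 * h ^+ 2) * v x ^+ 2)))).
  rewrite moment2; apply: le_Rintegral => //.
  - exact: Lfun2_sqr.
  - apply: integrableDr; first exact: i1.
    apply: integrableDr; first exact: z i2.
    apply: integrableDr; first exact: z i3.
    by apply: integrableDr; [exact: z i4|exact: z i5].
  - move=> x _; rewrite PE -subr_ge0.
    have -> : g x ^+ 2 + (2 * h * (g x * k x) + (2 * h * (g x * v x) +
        (2 * h ^+ 2 * k x ^+ 2 + 2 * h ^+ 2 * v x ^+ 2))) -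
        (g x + h * (k x + v x)) ^+ 2 = (h * (k x - v x)) ^+ 2 by ring.
    exact: sqr_ge0.
apply: (le_trans H).
have j4 := integrableDr (z (2 * h ^+ 2) _ i4) (z (2 * h ^+ 2) _ i5).
have j3 := integrableDr (z (2 * h) _ i3) j4.
have j2 := integrableDr (z (2 * h) _ i2) j3.
rewrite (RintegralD _ i1 j2)// (RintegralD _ (z _ _ i2) j3)//.
rewrite (RintegralD _ (z _ _ i3) j4)// (RintegralD _ (z _ _ i4) (z _ _ i5))//.
rewrite !RintegralZl// -!moment2.
move: gv pk mv gF kG.
set I := \int[mu]_x (g x * k x); set J := \int[mu]_x (g x * v x).
set A := moment mu 2 g; set B := moment mu 2 k; set V := moment mu 2 v.
rewrite ler_norml => /andP[_ J1] pk mv gF kG.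
have A0 : 0 <= A by exact: moment_ge0.
have ex : 1 + - (2 * h / C) <= expR (- (2 * h / C)) by exact: expR_ge1Dx.
have I1 : I <= - (A / C).
  by rewrite -mulNr ler_pdivlMr// mulrC -lerN2 opprK -mulNr.
have I2 : 2 * h * I <= - (2 * h / C) * A.
  rewrite (_ : - (2 * h / C) * A = 2 * h * - (A / C)); last by ring.
  by rewrite ler_wpM2l// mulr_ge0// ltW.
have J2 : 2 * h * J <= h * (e * (F + 1)).
  have : h * (2 * J) <= h * (e * (F + 1)).
    apply: ler_wpM2l; first exact: ltW.
    have : e * A <= e * F by rewrite ler_wpM2l// ltW.
    lra.
  by rewrite mulrCA mulrA.
have K2 : 2 * h ^+ 2 * B + 2 * h ^+ 2 * V <= h * (h * (2 * G + 2 * e ^+ 2)).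
  have -> : h * (h * (2 * G + 2 * e ^+ 2)) = 2 * h ^+ 2 * G + 2 * h ^+ 2 * e ^+ 2.
    by ring.
  by apply: lerD; rewrite ler_wpM2l// mulr_ge0// sqr_ge0.
have EA := ler_wpM2r A0 ex.
lra.
Qed.

(** Euler steps of length t / n, with an error that vanishes as n grows. *)
Lemma L2_decay_core f t : D f -> \int[mu]_x f x = 0 -> 0 <= t ->
  moment mu 2 (semigroup P t f) <= expR (- (2 * t / C)) * moment mu 2 f.
Proof.
move=> Df f0; rewrite le_eqVlt => /predU1P[<-|t0].
  rewrite mulr0 mul0r oppr0 expR0 mul1r; apply: (semigroup_moment ss le12) => //.
  by have [Dgen _ _] := core; have [] := Dgen f Df.
have [Dgen _ _] := core; have fg := Dgen f Df; have [f2 g2 _] := fg.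
set F := moment mu 2 f; set G := moment mu 2 (L f).
have F0 : 0 <= F by exact: moment_ge0.
have G0 : 0 <= G by exact: moment_ge0.
apply/ler_addgt0Pr => c c0.
pose e := c / (2 * t * (F + 1) + c).
have tF : 0 < 2 * t * (F + 1) by rewrite !mulr_gt0// ltr_wpDl.
have e0 : 0 < e by rewrite divr_gt0// addr_gt0.
have e1 : e <= 1 by rewrite ler_pdivrMr ?addr_gt0// mul1r lerDr ltW.
have te : t * (e * (F + 1)) <= c / 2.
  have : e * (2 * t * (F + 1)) <= c.
    by rewrite /e mulrAC ler_pdivrMr ?addr_gt0// ler_wpM2l ?ltW// ltrDl.
  lra.
have [d d0 near_d] := generator_near fg e0.
pose b := c / (2 * t * (2 * G + 2)).
have tG : 0 < 2 * t * (2 * G + 2) by rewrite !mulr_gt0// ltr_wpDl// mulr_ge0.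
have b0 : 0 < b by rewrite divr_gt0.
pose m := Num.min d b.
have m0 : 0 < m by rewrite lt_min d0.
pose n := (Num.truncn (t / m)).+1.
have n0 : 0 < n%:R :> R by rewrite ltr0n.
pose h := t / n%:R.
have h0 : 0 < h by rewrite divr_gt0.
have hm : h < m.
  have tn : t / m < n%:R by apply: real_truncnS_gt; exact: num_real.
  by rewrite /h ltr_pdivrMr// mulrC -ltr_pdivrMr.
have hd : h < d by rewrite (lt_le_trans hm)// ge_min lexx.
have hb : h <= b by rewrite ltW// (lt_le_trans hm)// ge_min lexx orbT.
have nh : n%:R * h = t by rewrite /h mulrC divfK// gt_eqF.
pose u j := moment mu 2 (semigroup P (j%:R * h) f).
pose eta := e * (F + 1) + h * (2 * G + 2 * e ^+ 2).
have eta0 : 0 <= eta.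
  apply: addr_ge0; apply: mulr_ge0 (ltW _) (addr_ge0 _ _) => //.
    by rewrite mulr_ge0.
  by rewrite mulr_ge0// sqr_ge0.
have tau0 j : 0 <= j%:R * h by rewrite mulr_ge0// ltW.
have urec j : u j.+1 <= expR (- (2 * h / C)) * u j + h * eta.
  have s0 := tau0 j; have fi := Lfun_integrable1 le12 f2.
  have Pf2 := semigroup_Lfun ss le12 s0 f2.
  have Pg2 := semigroup_Lfun ss le12 s0 g2.
  have -> : u j.+1 = moment mu 2 (semigroup P h (semigroup P (j%:R * h) f)).
    apply: ae_eq_moment.
    - exact: Lfun_measurable (semigroup_Lfun ss le12 (tau0 j.+1) f2).
    - exact: Lfun_measurable (semigroup_Lfun ss le12 (ltW h0) Pf2).
    - by apply: ae_mono (semigroupD ss (ltW h0) s0 fi) => x <-;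
        rewrite -natr1 mulrDl mul1r addrC.
  have [_ Q] := generator_quotient f2 g2 s0 (ltW h0).
  apply: (@euler_step _ (semigroup P (j%:R * h) (L f))) => //.
  - apply: poincare_generator; first exact: generator_semigroup.
    by rewrite (semigroup_mean ss s0 fi).
  - by apply: (le_trans Q); apply: ltW; exact: near_d.
  - exact: semigroup_moment.
  - exact: semigroup_moment.
have r1 : expR (- (2 * h / C)) <= 1.
  by rewrite expR_le1 oppr_le0 divr_ge0 ?mulr_ge0// ltW.
have := affine_recursion (expR_ge0 _) r1 (mulr_ge0 (ltW h0) eta0) urec n.
have un : u n = moment mu 2 (semigroup P t f) by rewrite /u nh.
rewrite un (mulrA n%:R h) nh -expRM_natl.
have -> : n%:R * - (2 * h / C) = - (2 * t / C) by rewrite -nh; ring.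
move=> H; apply: (le_trans H); apply: lerD.
  by rewrite ler_wpM2l ?expR_ge0//; apply: (semigroup_moment ss le12).
have te2 : t * (h * (2 * G + 2 * e ^+ 2)) <= c / 2.
  have ee : e ^+ 2 <= 1 by rewrite exprn_ile1// ltW.
  apply: (@le_trans _ _ (t * (b * (2 * G + 2)))).
    apply: ler_wpM2l; first exact: ltW.
    apply: ler_pM => //; first exact: ltW.
      by apply: addr_ge0; rewrite mulr_ge0// sqr_ge0.
    by rewrite lerD2l ler_piMr.
  have : b * (2 * t * (2 * G + 2)) = c by rewrite /b divfK// gt_eqF.
  lra.
by rewrite /eta mulrDr; lra.
Qed.

(** The exponential decay of the variance. *)
Lemma L2_decay f t : 0 <= t -> f \in Lfun mu 2%:E -> \int[mu]_x f x = 0 ->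
  rnorm mu 2 (semigroup P t f) <= expR (- (t / C)) * rnorm mu 2 f.
Proof.
move=> t0; have [Dgen dense _] := core; have [Dc Dadd _] := alg.
have D2 h : D h -> (h : borel E -> R) \in Lfun mu 2%:E.
  by move=> /Dgen[].
move: f; apply: (rnorm_decay_dense ss le12 t0 (expR_ge0 _) D2).
- by move=> h a Dh; exact: (Dadd _ (cst (- a)) Dh (Dc _)).
- move=> f f2 e e0; have [h Dh hf] := dense f f2 e e0; exists h => //.
  by apply: Lp_norm_lt hf; apply: Lfun_subf => //; exact: D2.
- move=> h Dh h0.
  have := rnorm_le le12 (expR_ge0 _) (L2_decay_core Dh h0 t0).
  rewrite -expRM (_ : - (2 * t / C) / 2 = - (t / C))//.
  by field; rewrite gt_eqF.
Qed.

End L2Decay.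

(** * L^p decay for p at least 2 *)

Section LpDecay.
Context {R : realType} {E : completePseudoMetricType R}.
Variables (mu : probability (borel E) R)
          (P : R -> R.-pker (borel E) ~> (borel E)) (C : R).
Hypotheses (ss : symmetric_semigroup mu P) (C0 : 0 < C)
  (L2dec : forall t (f : borel E -> R), 0 <= t -> f \in Lfun mu 2%:E ->
     \int[mu]_x f x = 0 ->
     rnorm mu 2 (semigroup P t f) <= expR (- (t / C)) * rnorm mu 2 f).

Local Notation integrable f := (mu.-integrable [set: borel E] (EFin \o f)).
Implicit Types (f g : borel E -> R) (p q s t : R).

Let le12 : 1 <= 2 :> R. Proof. by rewrite ler1n. Qed.
Let mu1 : mu setT = 1%E. Proof. exact: probability_setT. Qed.

Lemma expR_rate_sqr t : expR (- (t / C)) ^+ 2 = expR (- (2 * t / C)).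
Proof. by rewrite -expRM_natl; congr expR; ring. Qed.

Lemma L2_decay_moment t f : 0 <= t -> f \in Lfun mu 2%:E ->
  \int[mu]_x f x = 0 ->
  moment mu 2 (semigroup P t f) <= expR (- (2 * t / C)) * moment mu 2 f.
Proof.
move=> t0 f2 f0; have H := L2dec t0 f2 f0.
rewrite -(rnorm_powR mu f le12) -(rnorm_powR mu (semigroup P t f) le12).
rewrite !powR_mulrn ?rnorm_ge0// -expR_rate_sqr -exprMn.
by apply: lerXn2r; rewrite ?nnegrE ?rnorm_ge0// mulr_ge0 ?expR_ge0 ?rnorm_ge0.
Qed.

Lemma moment2_shift f (m : R) : f \in Lfun mu 2%:E -> \int[mu]_x f x = 0 ->
  moment mu 2 (fun x => f x + m) = moment mu 2 f + m ^+ 2.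
Proof.
move=> f2 f0; have fi := Lfun_integrable1 le12 f2; rewrite !moment2.
have ci : integrable (fun=> m ^+ 2) by exact: integrable_cst.
have zi : integrable (fun x => (2 * m) * f x) by exact: integrableZ.
rewrite (_ : \int[mu]_x ((f x + m) ^+ 2) =
  \int[mu]_x (f x ^+ 2 + ((2 * m) * f x + m ^+ 2))); last first.
  by apply: eq_Rintegral => x _; ring.
rewrite (RintegralD _ (Lfun2_sqr f2) (integrableDr zi ci))//.
by rewrite (RintegralD _ zi ci)// RintegralZl// f0 mulr0 add0r (Rintegral_cst1 mu1).
Qed.

Lemma var_decay t g : 0 <= t -> g \in Lfun mu 2%:E ->
  moment mu 2 (semigroup P t g) <=
  expR (- (2 * t / C)) * moment mu 2 g +
  (1 - expR (- (2 * t / C))) * (\int[mu]_x g x) ^+ 2.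
Proof.
move=> t0 g2; set m := \int[mu]_x g x; have gi := Lfun_integrable1 le12 g2.
have c2 : (fun=> m) \in Lfun mu 2%:E by exact: Lfun_cstf.
have ci : integrable (fun=> m) by exact: integrable_cst.
have h2 := Lfun_subf le12 g2 c2; have hi := Lfun_integrable1 le12 h2.
have Ph2 := semigroup_Lfun ss le12 t0 h2.
set h := (fun x => _) in h2 hi Ph2.
have h0 : \int[mu]_x h x = 0.
  by rewrite RintegralB// (Rintegral_cst1 mu1) subrr.
have gE : moment mu 2 g = moment mu 2 h + m ^+ 2.
  rewrite -moment2_shift//; congr (moment mu 2 _).
  by apply/funext => x; rewrite /h subrK.
have PgE : moment mu 2 (semigroup P t g) = moment mu 2 (semigroup P t h) + m ^+ 2.
  rewrite -moment2_shift//; last by rewrite (semigroup_mean ss).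
  apply: ae_eq_moment.
  - exact: Lfun_measurable (semigroup_Lfun ss le12 t0 g2).
  - exact: Lfun_measurable (Lfun_addf le12 Ph2 c2).
  - apply: ae_mono (ae_semigroup_sub ss t0 gi ci) => x ->.
    by rewrite semigroup_cst subrK.
rewrite PgE gE.
have -> (r A M : R) : r * (A + M) + (1 - r) * M = r * A + M by ring.
by rewrite lerD2r; exact: L2_decay_moment.
Qed.

(** The moment of order q along one step of the semi-group, from Jensen's
    inequality for the kernel and the decay of the variance of |f|^(q/2). *)
Lemma moment_step q t f : 2 <= q -> 0 <= t -> f \in Lfun mu q%:E ->
  moment mu q (semigroup P t f) <=
  expR (- (2 * t / C)) * moment mu q f +
  (1 - expR (- (2 * t / C))) * moment mu (q / 2) f ^+ 2.
Proof.
move=> q2 t0 fq; have q1 : 1 <= q by rewrite (le_trans _ q2)// ler1n.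
have s1 : 1 <= q / 2 by lra.
have qE : q / 2 * 2 = q by rewrite divfK.
pose g x := `|f x| `^ (q / 2).
have g2 : g \in Lfun mu 2%:E by apply: Lfun_powR => //; rewrite qE.
have gi := Lfun_integrable1 le12 g2.
have fi := Lfun_integrable1 q1 fq.
have Pfq := semigroup_Lfun ss q1 t0 fq.
have Pg2 := semigroup_Lfun ss le12 t0 g2.
have := var_decay t0 g2.
rewrite /g moment_powR qE -/g.
have -> : \int[mu]_x g x = moment mu (q / 2) f by rewrite moment.unlock.
apply: le_trans.
rewrite -{1}qE -moment_powR !moment2.
apply: ae_le_Rintegral.
- by apply: Lfun2_sqr; apply: Lfun_powR => //; rewrite qE.
- exact: Lfun2_sqr.
- have inv := semigroup_invariant ss t0.
  apply: ae_mono2 (ae_integrable_kernel inv fi) (ae_integrable_kernel inv gi).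
  move=> x fx gx; apply: lerXn2r.
  + by rewrite nnegrE powR_ge0.
  + by rewrite nnegrE; apply: Rintegral_ge0 => y _; exact: powR_ge0.
  + exact: norm_semigroup_powR.
Qed.

(** The orbit of f sampled at n steps of length t / n. *)
Section Steps.
Variables (q t : R) (f : borel E -> R) (n : nat).
Hypotheses (q2 : 2 <= q) (t0 : 0 <= t) (n0 : (0 < n)%N)
  (fq : f \in Lfun mu q%:E) (f0 : \int[mu]_x f x = 0).

Let q1 : 1 <= q. Proof. by rewrite (le_trans _ q2)// ler1n. Qed.
Let h := t / n%:R.
Let h0 : 0 <= h. Proof. by rewrite divr_ge0. Qed.
Let f2 : f \in Lfun mu 2%:E. Proof. exact: Lfun_le fq. Qed.
Let jh0 j : 0 <= j%:R * h. Proof. by rewrite mulr_ge0. Qed.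
Let F j := semigroup P (j%:R * h) f.
Let rho := expR (- (2 * h / C)).

Let Fq j : F j \in Lfun mu q%:E. Proof. exact: semigroup_Lfun. Qed.

Lemma steps_last : F n = semigroup P t f.
Proof. by rewrite /F /h mulrC divfK// pnatr_eq0 -lt0n. Qed.

Lemma steps_first : moment mu q (F 0) <= moment mu q f.
Proof. by rewrite /F; exact: semigroup_moment. Qed.

Lemma steps_moment j : moment mu q (F j.+1) <=
  rho * moment mu q (F j) + (1 - rho) * moment mu (q / 2) (F j) ^+ 2.
Proof.
have -> : moment mu q (F j.+1) = moment mu q (semigroup P h (F j)).
  apply: ae_eq_moment.
  - exact: Lfun_measurable (Fq _).
  - exact: Lfun_measurable (semigroup_Lfun ss q1 h0 (Fq j)).
  - apply: ae_mono (semigroupD ss h0 (jh0 j) (Lfun_integrable1 q1 fq)) => x <-.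
    by rewrite /F -natr1 mulrDl mul1r addrC.
exact: moment_step.
Qed.

Lemma steps_moment2 j : moment mu 2 (F j) <= rho ^+ j * moment mu 2 f.
Proof.
apply: le_trans (L2_decay_moment (jh0 j) f2 f0) _.
rewrite le_eqVlt; apply/orP; left; apply/eqP; congr (_ * _).
by rewrite /rho -expRM_natl; congr expR; ring.
Qed.

Let rho1 : rho <= 1.
Proof. by rewrite expR_le1 oppr_le0 divr_ge0 ?mulr_ge0// ltW. Qed.

Let rho0 : 0 <= rho. Proof. exact: expR_ge0. Qed.

(** Lyapunov's inequality: below order 4 the lower moment is controlled by the
    second one. *)
Lemma steps_half_le4 j : q <= 4 ->
  moment mu (q / 2) (F j) ^+ 2 <= expR (- (h / C)) ^+ j * moment mu q f.
Proof.
move=> q4; have s1 : 1 <= q / 2 by have := q2; lra.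
have s0 : 0 < q / 2 by lra.
have F2 : F j \in Lfun mu 2%:E by exact: Lfun_le (Fq j).
have s2 : q / 2 <= 2 by lra.
have H1 := moment_mono s1 s2 F2.
have H2 := moment_mono le12 q2 fq.
have e1 : expR (- (h / C)) <= 1.
  by rewrite expR_le1 oppr_le0 divr_ge0// ltW.
set s := expR (- (h / C)) in e1 *.
have sr : rho = s ^+ 2 by rewrite /rho /s expR_rate_sqr.
have se0 : 0 <= s by exact: expR_ge0.
have -> : moment mu (q / 2) (F j) ^+ 2 =
    (moment mu (q / 2) (F j) `^ (2 / (q / 2))) `^ (q / 2).
  by rewrite -powRrM divfK ?gt_eqF// powR_mulrn// moment_ge0.
apply: (@le_trans _ _ ((rho ^+ j * moment mu 2 f) `^ (q / 2))).
  apply: ge0_ler_powR; rewrite ?nnegrE ?powR_ge0 ?(ltW s0)//.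
    by rewrite mulr_ge0 ?moment_ge0// exprn_ge0.
  exact: le_trans H1 (steps_moment2 j).
rewrite powRM ?moment_ge0 ?exprn_ge0//.
apply: ler_pM => //; rewrite ?powR_ge0//.
apply: (@le_trans _ _ (rho ^+ j)).
  by apply: ge1r_powR => //; rewrite exprn_gt0 ?expR_gt0//= exprn_ile1.
by rewrite sr -exprM mulnC exprM expr2 ler_piMr ?exprn_ge0// exprn_ile1.
Qed.

(** Cauchy-Schwarz and interpolation: above order 4 the second moment can be
    factored out of the square of the lower one. *)
Lemma steps_half_ge4 j : 4 <= q -> 0 < moment mu q f ->
  moment mu (q / 2) (F j) ^+ 2 <=
  rho ^+ j * Num.max (moment mu q f * rho ^+ j) (moment mu q (F j)).
Proof.
move=> q4; set V := moment mu q f => V0.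
have q0 : 0 < q by lra.
pose N := rnorm mu q f.
have NV : N `^ q = V by exact: rnorm_powR.
have N0 : 0 < N.
  rewrite lt_neqAle rnorm_ge0 andbT eq_sym; apply: contraPneq V0 => N0.
  by rewrite -NV N0 powR0 ?gt_eqF// ltxx.
have F2 : F j \in Lfun mu 2%:E by exact: Lfun_le (Fq j).
set w := moment mu 2 (F j); set u := moment mu q (F j).
have w0 : 0 <= w by exact: moment_ge0.
have u0 : 0 <= u by exact: moment_ge0.
have rj0 : 0 <= rho ^+ j by exact: exprn_ge0.
have q21 : 1 <= q - 2 by lra.
have Fq2 : F j \in Lfun mu (q - 2)%:E by apply: Lfun_le (Fq j) => //; lra.
have wN : w <= rho ^+ j * N ^+ 2.
  apply: (le_trans (steps_moment2 j)); rewrite ler_wpM2l//.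
  have H := moment_mono le12 q2 fq.
  have qi : 0 <= 2 / q by rewrite divr_ge0// ltW.
  have := ge0_ler_powR qi _ _ H; rewrite !nnegrE powR_ge0 moment_ge0.
  move=> /(_ isT isT); rewrite -powRrM (_ : q / 2 * (2 / q) = 1); last first.
    by field; rewrite gt_eqF.
  rewrite powRr1 ?moment_ge0// => /le_trans; apply.
  rewrite -/V -NV -powRrM mulrCA divff ?gt_eqF// mulr1 powR_mulrn//.
  exact: ltW.
(* Cauchy-Schwarz for |F| and |F|^(q/2 - 1) *)
have CS : moment mu (q / 2) (F j) ^+ 2 <= w * moment mu (q - 2) (F j).
  pose a x := `|F j x| `^ 1; pose b x := `|F j x| `^ (q / 2 - 1).
  have eb : (q / 2 - 1) * 2 = q - 2 by lra.
  have a2 : a \in Lfun mu 2%:E by apply: Lfun_powR => //; rewrite mul1r.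
  have b2 : b \in Lfun mu 2%:E by apply: Lfun_powR => //; rewrite eb.
  have ii : 2^-1 + 2^-1 = 1 :> R by lra.
  have [_] := holder_moment le12 le12 ii a2 b2.
  have -> : \int[mu]_x (a x * b x) = moment mu (q / 2) (F j).
    rewrite moment.unlock; apply: eq_Rintegral => x _.
    by rewrite /a /b powRr1// mulr_powRB1//; lra.
  rewrite /a /b !moment_powR eb mul1r ger0_norm ?moment_ge0// => H.
  have := lerXn2r 2 _ _ H; rewrite !nnegrE moment_ge0 mulr_ge0 ?powR_ge0//.
  move=> /(_ isT isT) /le_trans; apply.
  by rewrite exprMn -!powR_mulrn ?powR_ge0// -!powRrM mulVf// !powRr1 ?moment_ge0.
apply: (le_trans CS).
pose al := (q - 4) / (q - 2).
have q20 : 0 < q - 2 by lra.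
have al0 : 0 <= al by apply: divr_ge0; lra.
have al1 : al <= 1 by rewrite ler_pdivrMr// mul1r; lra.
have B : moment mu (q - 2) (F j) <=
    N `^ (q - 2) * ((1 - al) * (w / N ^+ 2) + al * (u / V)).
  have i2 := Lfun2_sqr F2; have [_ iq] := (LfunE _ _ q1).1 (Fq j).
  have z (a : R) g : integrable g -> integrable (fun x => a * g x).
    exact: integrableZ.
  have [_ iq2] := (LfunE _ _ q21).1 Fq2.
  pose c1 := N `^ (q - 2) * ((1 - al) / N ^+ 2); pose c2 := N `^ (q - 2) * (al / V).
  have -> : N `^ (q - 2) * ((1 - al) * (w / N ^+ 2) + al * (u / V)) =
      \int[mu]_x (c1 * F j x ^+ 2 + c2 * `|F j x| `^ q).
    rewrite (RintegralD _ (z c1 _ i2) (z c2 _ iq))// !RintegralZl// -moment2 -/w.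
    have -> : \int[mu]_x `|F j x| `^ q = u by rewrite /u moment.unlock.
    by rewrite /c1 /c2; ring.
  rewrite moment.unlock; apply: le_Rintegral => //.
    by apply: integrableDr; exact: z.
  move=> x _; apply: (le_trans (powR_interp q4 (normr_ge0 _) N0)).
  rewrite NV real_normK ?num_real// -/al /c1 /c2.
  by rewrite le_eqVlt; apply/orP; left; apply/eqP; ring.
have NN : N ^+ 2 * N `^ (q - 2) = V.
  rewrite -powR_mulrn ?ltW// -powRD; last by apply/implyP => _; rewrite gt_eqF.
  by rewrite -NV; congr (_ `^ _); lra.
have N20 : 0 < N ^+ 2 by rewrite exprn_gt0.
have Np0 : 0 <= N `^ (q - 2) by exact: powR_ge0.
set M := Num.max _ _.
have M1 : rho ^+ j <= M / V by rewrite ler_pdivlMr// mulrC le_max lexx.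
have M2 : u / V <= M / V by rewrite ler_pM2r ?invr_gt0// le_max lexx orbT.
have B' : (1 - al) * (w / N ^+ 2) + al * (u / V) <= M / V.
  have -> : M / V = (1 - al) * (M / V) + al * (M / V) by ring.
  apply: lerD; apply: ler_wpM2l => //; first by rewrite subr_ge0.
  by apply: le_trans M1; rewrite ler_pdivrMr.
apply: (@le_trans _ _ ((rho ^+ j * N ^+ 2) * (N `^ (q - 2) * (M / V)))).
  apply: ler_pM => //; first exact: moment_ge0.
  by apply: (le_trans B); rewrite ler_wpM2l.
by rewrite -mulrA [N ^+ 2 * _]mulrA NN [V * _]mulrC divfK ?gt_eqF.
Qed.

End Steps.

Lemma rate_steps t n : (0 < n)%N -> expR (- (t / n%:R / C)) ^+ n = expR (- (t / C)).
Proof.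
by move=> n0; rewrite -expRM_natl; congr expR; field;
  rewrite gt_eqF// pnatr_eq0 -lt0n n0.
Qed.

Lemma moment_decay_le4 q t f : 2 <= q -> q <= 4 -> 0 <= t ->
  f \in Lfun mu q%:E -> \int[mu]_x f x = 0 ->
  moment mu q (semigroup P t f) <= 4 * expR (- (t / C)) * moment mu q f.
Proof.
move=> q2 q4 t0 fq f0.
have [n n0 hn] := exists_steps (divr_ge0 t0 (ltW C0)).
set s := expR (- (t / n%:R / C)).
have s89 : 8 / 9 <= s by rewrite /s mulrAC.
have s1 : s <= 1 by rewrite expR_le1 oppr_le0 !divr_ge0// ltW.
have s2 : expR (- (2 * (t / n%:R) / C)) = s ^+ 2 by rewrite expR_rate_sqr.
pose u j := moment mu q (semigroup P (j%:R * (t / n%:R)) f).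
have := @recursion_sqrt _ u
  (fun j => moment mu (q / 2) (semigroup P (j%:R * (t / n%:R)) f) ^+ 2)
  s (moment mu q f) _ s1 (moment_ge0 _ _ _) _ _ _ n.
rewrite /u steps_last// rate_steps//; apply.
- lra.
- by move=> j; rewrite -s2; exact: steps_moment.
- by move=> j; exact: steps_half_le4.
- exact: steps_first.
Qed.

Lemma moment_decay_ge4 q t f : 4 <= q -> 0 <= t ->
  f \in Lfun mu q%:E -> \int[mu]_x f x = 0 ->
  moment mu q (semigroup P t f) <= 4 * expR (- (2 * t / C)) * moment mu q f.
Proof.
move=> q4 t0 fq f0; have q2 : 2 <= q by lra.
have q1 : 1 <= q by lra.
have [V0|V0] := eqVneq (moment mu q f) 0.
  by rewrite V0 mulr0 -V0; exact: semigroup_moment.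
have {}V0 : 0 < moment mu q f by rewrite lt_neqAle eq_sym V0 moment_ge0.
have tC0 : 0 <= 2 * t / C by rewrite divr_ge0 ?mulr_ge0// ltW.
have [n n0 hn] := exists_steps tC0.
set r := expR (- (2 * (t / n%:R) / C)).
have rE : r = expR (- (2 * t / C / n%:R)) by congr expR; ring.
have r1 : r <= 1 by rewrite expR_le1 oppr_le0 divr_ge0 ?mulr_ge0 ?divr_ge0// ltW.
pose u j := moment mu q (semigroup P (j%:R * (t / n%:R)) f).
have := @recursion_max _ u r (moment mu q f) _ r1 (moment_ge0 _ _ _) _ _ n.
rewrite /u steps_last//.
have -> : r ^+ n = expR (- (2 * t / C)).
  by rewrite /r -!expR_rate_sqr exprAC rate_steps.
apply.
- by rewrite rE.
- move=> j; apply: (le_trans (steps_moment _ _ _ _ j)) => //.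
  by rewrite lerD2l ler_wpM2l ?subr_ge0//; exact: steps_half_ge4.
- exact: steps_first.
Qed.

End LpDecay.

(** * Truncation and duality *)

Section Truncation.
Context {R : realType} {d : measure_display} {T : measurableType d}.
Variable mu : probability T R.

Local Notation integrable f := (mu.-integrable [set: T] (EFin \o f)).

(** The truncation of f at level n: f where |f| <= n, and 0 elsewhere. *)
Definition trunc (f : T -> R) (n : nat) : T -> R :=
  fun x => if `|f x| <= n%:R then f x else 0.

Lemma measurable_trunc f n : measurable_fun setT f ->
  measurable_fun setT (trunc f n).
Proof.
move=> mf; apply: measurable_fun_ifT => //.
by apply: measurable_fun_ler => //; exact: measurableT_comp.
Qed.

Lemma trunc_Lfun f n p : 1 <= p -> measurable_fun setT f ->
  trunc f n \in Lfun mu p%:E.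
Proof.
move=> p1 mf; have p0 : 0 <= p by rewrite (le_trans ler01).
apply/LfunE => //; split; first exact: measurable_trunc.
apply: (@le_integrable_fun _ _ _ _ _ (fun=> n%:R `^ p)).
- exact/measurable_norm_powR/measurable_trunc.
- move=> x; rewrite ger0_norm ?powR_ge0//; apply: ge0_ler_powR => //;
    rewrite ?nnegrE//.
  by rewrite /trunc; case: ifP => // _; rewrite normr0.
- by apply: integrable_cst; exact: probability_setT.
Qed.

Lemma trunc_cvg f p (x : T) : 0 < p ->
  (`|trunc f n x - f x| `^ p)%:E @[n --> \oo] --> 0%E.
Proof.
move=> p0; apply: cvg_near_cst.
exists (Num.truncn `|f x|).+1 => // n /= nx.
rewrite /trunc ifT ?subrr ?normr0 ?powR0 ?gt_eqF//.
apply: (@le_trans _ _ (Num.truncn `|f x|).+1%:R); last by rewrite ler_nat.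
by apply: ltW; apply: real_truncnS_gt; exact: num_real.
Qed.

Lemma trunc_dense f p : 1 <= p -> f \in Lfun mu p%:E -> forall e : R, 0 < e ->
  exists n, rnorm mu p (fun x => trunc f n x - f x) < e.
Proof.
move=> p1 fp e e0; have p0 : 0 < p by rewrite (lt_le_trans ltr01).
have [mf fi] := (LfunE _ _ p1).1 fp.
have dp n := Lfun_subf p1 (trunc_Lfun n p1 mf) fp.
have mg n : measurable_fun setT (fun x => (`|trunc f n x - f x| `^ p)%:E).
  by apply/measurable_EFinP/measurable_norm_powR; exact: Lfun_measurable (dp n).
have lim0 : {ae mu, forall x, setT x ->
    (`|trunc f n x - f x| `^ p)%:E @[n --> \oo] --> cst 0%E x}.
  by apply: aeW => x _; exact: trunc_cvg.
have dom : {ae mu, forall x n, setT x ->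
    (`|(`|trunc f n x - f x| `^ p)%:E| <= (`|f x| `^ p)%:E)%E}.
  apply: aeW => x n _; rewrite abse_EFin lee_fin ger0_norm ?powR_ge0//.
  apply: ge0_ler_powR; rewrite ?nnegrE ?(ltW p0)//.
  by rewrite /trunc; case: ifP; rewrite ?subrr ?normr0// sub0r normrN.
have [_ _] := dominated_convergence measurableT mg (measurable_cst _) lim0 fi dom.
rewrite integral_cst// mul0e => lim.
have ep : 0 < e `^ p by rewrite powR_gt0.
have U : nbhs (0%E : \bar R) [set y : \bar R | (y < (e `^ p)%:E)%E].
  by apply: open_nbhs_nbhs; split; [exact: open_ereal_lt_ereal|rewrite /= lte_fin].
have [n _ /(_ n (leqnn n)) /= H] := lim _ U.
exists n; have {}H : moment mu p (fun x => trunc f n x - f x) < e `^ p.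
  rewrite -lte_fin; apply: le_lt_trans H.
  rewrite moment.unlock /Rintegral fineK//.
  have [_ ifp] := (LfunE _ _ p1).1 (dp n).
  exact: (integrable_fin_num measurableT ifp).
rewrite rnorm.unlock -[ltRHS](powRr1 (ltW e0)) -(mulfV (lt0r_neq0 p0)) powRrM.
by apply: gt0_ltr_powR; rewrite ?invr_gt0 ?nnegrE ?moment_ge0 ?powR_ge0.
Qed.

End Truncation.

Section Duality.
Context {R : realType} {E : completePseudoMetricType R}.
Variables (mu : probability (borel E) R)
          (P : R -> R.-pker (borel E) ~> (borel E)).
Hypotheses (ss : symmetric_semigroup mu P).

Local Notation integrable f := (mu.-integrable [set: borel E] (EFin \o f)).
Implicit Types (f g : borel E -> R) (p q s t : R).

Let le12 : 1 <= 2 :> R. Proof. by rewrite ler1n. Qed.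
Let mu1 : mu setT = 1%E. Proof. exact: probability_setT. Qed.

(** If the signed power of order q of g has mean zero, then centring g at its
    mean multiplies its moment of order q by at most 2^(q-2) instead of the
    2^q given by the triangle inequality. *)
Lemma moment_centering q g : 2 <= q -> g \in Lfun mu q%:E ->
  integrable (fun x => spow q (g x)) -> \int[mu]_x spow q (g x) = 0 ->
  moment mu q (fun x => g x - \int[mu]_y g y) <= 2 `^ (q - 2) * moment mu q g.
Proof.
move=> q2 gq si s0; have q1 : 1 <= q by lra.
have q0 : 0 < q by lra.
have gi := Lfun_integrable1 q1 gq; have [_ gqi] := (LfunE _ _ q1).1 gq.
set m := \int[mu]_y g y; set c := spow q m.
have cq : (fun=> m) \in Lfun mu q%:E by exact: Lfun_cstf.
have [_ dqi] := (LfunE _ _ q1).1 (Lfun_subf q1 gq cq).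
have z (a : R) u : integrable u -> integrable (fun x => a * u x).
  exact: integrableZ.
have ci : integrable (fun=> m * c) by exact: integrable_cst.
have H : moment mu q (fun x => g x - m) <= \int[mu]_x
    (2 `^ (q - 2) * (`|g x| `^ q + (- m * spow q (g x) + (- c * g x + m * c)))).
  rewrite moment.unlock; apply: le_Rintegral => //.
    apply: integrableZ; apply: integrableDr; first exact: gqi.
    apply: integrableDr; first exact: z si.
    by apply: integrableDr; [exact: z gi|exact: ci].
  move=> x _; apply: (le_trans (spow_strong_mono _ _ q2)).
  rewrite le_eqVlt; apply/orP; left; apply/eqP; congr (_ * _).
  by rewrite -(mul_spow (g x) q0) -/c; ring.
apply: (le_trans H).
have j1 := integrableDr (z (- c) _ gi) ci.
have j2 := integrableDr (z (- m) _ si) j1.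
rewrite (RintegralZl _ measurableT (integrableDr gqi j2)).
rewrite (RintegralD measurableT gqi j2) (RintegralD measurableT (z (- m) _ si) j1).
rewrite (RintegralD measurableT (z (- c) _ gi) ci).
rewrite (RintegralZl _ measurableT si) (RintegralZl _ measurableT gi).
rewrite (Rintegral_cst1 mu1) s0 mulr0 add0r -/m mulNr [c * m]mulrC addNr addr0.
by rewrite moment.unlock.
Qed.

(** Duality: the decay of the moment of order q on functions of mean zero
    yields the decay at the conjugate exponent p, first for square-integrable
    functions. *)
Lemma dual_decay_L2 p q t (r : R) : 1 < p -> p < 2 -> p^-1 + q^-1 = 1 ->
  0 <= t -> 0 <= r ->
  (forall g, g \in Lfun mu q%:E -> \int[mu]_x g x = 0 ->
     moment mu q (semigroup P t g) <= 4 * r * moment mu q g) ->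
  forall h, h \in Lfun mu 2%:E -> \int[mu]_x h x = 0 ->
     rnorm mu p (semigroup P t h) <= 2 * r `^ q^-1 * rnorm mu p h.
Proof.
move=> p1 p2 pq t0 r0 decay h h2 h0.
have pp1 := ltW p1; have p0 : 0 < p by lra.
have pm0 : 0 < p - 1 by lra.
have qE : q = p / (p - 1).
  have qi : q^-1 = (p - 1) / p.
    by rewrite mulrBl divff ?gt_eqF// mul1r -pq addrC addKr.
  by rewrite -[q]invrK qi invf_div.
have qm : (p - 1) * (q - 1) = 1 by rewrite qE; field; rewrite gt_eqF.
have pmq : (p - 1) * q = p by rewrite qE mulrC divfK// gt_eqF.
have q2 : 2 <= q by rewrite qE ler_pdivlMr//; lra.
have q1 : 1 < q by lra.
have qq1 := ltW q1; have q0 : 0 < q by lra.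
pose F : borel E -> R := semigroup P t h.
have F2 : F \in Lfun mu 2%:E by exact: semigroup_Lfun.
have Fp : F \in Lfun mu p%:E by apply: Lfun_le F2 => //; exact: ltW.
have hp : h \in Lfun mu p%:E by apply: Lfun_le h2 => //; exact: ltW.
have hi := Lfun_integrable1 le12 h2.
have F0 : \int[mu]_x F x = 0 by rewrite (semigroup_mean ss).
(* the extremal test function *)
pose g (x : borel E) := spow p (F x).
have mg : measurable_fun setT g.
  by apply: (measurableT_comp (measurable_spow p)); exact: Lfun_measurable F2.
have gE x : `|g x| `^ q = `|F x| `^ p by rewrite norm_spow// -powRrM pmq.
have gq : g \in Lfun mu q%:E.
  apply/LfunE => //; split => //; have [_ Fi] := (LfunE _ _ pp1).1 Fp.
  by move: Fi; apply: eq_integrable => // x _ /=; rewrite gE.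
have gM : moment mu q g = moment mu p F.
  by rewrite moment.unlock; apply: eq_Rintegral => x _; rewrite gE.
have sg x : spow q (g x) = F x by rewrite spow_conj.
have si : integrable (fun x => spow q (g x)).
  have := Lfun_integrable1 le12 F2; apply: eq_integrable => // x _ /=.
  by rewrite sg.
have s0 : \int[mu]_x spow q (g x) = 0.
  by rewrite -[RHS]F0; apply: eq_Rintegral => x _; rewrite sg.
have cent := moment_centering q2 gq si s0; rewrite gM in cent.
set m := \int[mu]_y g y in cent.
pose k (x : borel E) := g x - m.
have mq : (fun=> m) \in Lfun mu q%:E by exact: Lfun_cstf.
have kq : k \in Lfun mu q%:E by exact: Lfun_subf.
have k2 : k \in Lfun mu 2%:E by exact: Lfun_le kq.
have gi := Lfun_integrable1 qq1 gq.
have ci : integrable (fun=> m) by exact: integrable_cst.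
have k0 : \int[mu]_x k x = 0 by rewrite RintegralB// (Rintegral_cst1 mu1) subrr.
have Pkq := semigroup_Lfun ss qq1 t0 kq.
(* pairing F with g, then moving the semi-group onto the centred g *)
have FE : moment mu p F = \int[mu]_x (h x * semigroup P t k x).
  rewrite (ss_symmetric ss t0 h2 k2) -/F.
  have kFi : integrable (fun x => k x * F x) by exact: Lfun2_mul.
  have cFi : integrable (fun x => m * F x).
    by apply: integrableZ; exact: Lfun_integrable1 F2.
  have -> : moment mu p F = \int[mu]_x (k x * F x + m * F x).
    rewrite moment.unlock; apply: eq_Rintegral => x _.
    by rewrite -(mul_spow (F x) p0) /k -mulrDl subrK mulrC.
  rewrite RintegralD// RintegralZl//; last exact: Lfun_integrable1 F2.
  by rewrite F0 mulr0 addr0.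
have [_ Hol] := holder_moment pp1 qq1 pq hp Pkq.
rewrite -FE ger0_norm ?moment_ge0// in Hol.
have kM : moment mu q (semigroup P t k) <= r * 2 `^ q * moment mu p F.
  apply: (le_trans (decay k kq k0)).
  have -> : r * 2 `^ q * moment mu p F = 4 * r * (2 `^ (q - 2) * moment mu p F).
    have -> : (2 : R) `^ q = 2 `^ (q - 2) * 2 `^ 2.
      by rewrite -powRD ?subrK// pnatr_eq0 implybT.
    by rewrite powR_mulrn//; ring.
  by rewrite ler_wpM2l// mulr_ge0.
set A := rnorm mu p F.
have A0 : 0 <= A by exact: rnorm_ge0.
have AF : A `^ p = moment mu p F by exact: rnorm_powR.
have kN : moment mu q (semigroup P t k) `^ q^-1 <= r `^ q^-1 * 2 * A `^ (p - 1).
  have -> : r `^ q^-1 * 2 * A `^ (p - 1) = (r * 2 `^ q * moment mu p F) `^ q^-1.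
    rewrite -AF !powRM ?mulr_ge0 ?powR_ge0// -!powRrM mulfV ?gt_eqF// powRr1//.
    by rewrite -{2}pmq mulfK ?gt_eqF.
  apply: ge0_ler_powR => //; first by rewrite invr_ge0 ltW.
    by rewrite nnegrE moment_ge0.
  by rewrite nnegrE !mulr_ge0 ?powR_ge0 ?moment_ge0.
have [A00|A00] := eqVneq A 0.
  by rewrite A00 !mulr_ge0 ?powR_ge0 ?rnorm_ge0.
have Ap : 0 < A `^ (p - 1) by rewrite powR_gt0// lt_neqAle eq_sym A00.
rewrite -(ler_pM2r Ap) mulr_powRB1// AF.
apply: (le_trans Hol).
rewrite (_ : 2 * r `^ q^-1 * rnorm mu p h * A `^ (p - 1) =
  rnorm mu p h * (r `^ q^-1 * 2 * A `^ (p - 1))); last by ring.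
by rewrite {1}rnorm.unlock; apply: ler_wpM2l kN; exact: powR_ge0.
Qed.

Lemma dual_decay p q t (r : R) : 1 < p -> p < 2 -> p^-1 + q^-1 = 1 ->
  0 <= t -> 0 <= r ->
  (forall g, g \in Lfun mu q%:E -> \int[mu]_x g x = 0 ->
     moment mu q (semigroup P t g) <= 4 * r * moment mu q g) ->
  forall f, f \in Lfun mu p%:E -> \int[mu]_x f x = 0 ->
     rnorm mu p (semigroup P t f) <= 2 * r `^ q^-1 * rnorm mu p f.
Proof.
move=> p1 p2 pq t0 r0 decay.
apply: (rnorm_decay_dense ss (ltW p1) t0 _ (S := [set h | h \in Lfun mu 2%:E])).
- by rewrite mulr_ge0// powR_ge0.
- by move=> h /= h2; apply: Lfun_le h2; exact: ltW.
- by move=> h a /= h2; apply: Lfun_subf => //; exact: Lfun_cstf.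
- move=> f fp e e0; have [n fn] := trunc_dense (ltW p1) fp e0.
  by exists (trunc f n) => //=; apply: trunc_Lfun => //; exact: Lfun_measurable fp.
- exact: dual_decay_L2.
Qed.

End Duality.

(** * Conclusion *)

Section Conclusion.
Context {R : realType} {E : completePseudoMetricType R}.
Variables (mu : probability (borel E) R)
          (P : R -> R.-pker (borel E) ~> (borel E)) (C : R).
Hypotheses (ss : symmetric_semigroup mu P) (C0 : 0 < C)
  (L2dec : forall t (f : borel E -> R), 0 <= t -> f \in Lfun mu 2%:E ->
     \int[mu]_x f x = 0 ->
     rnorm mu 2 (semigroup P t f) <= expR (- (t / C)) * rnorm mu 2 f).
Implicit Types (f : borel E -> R) (p q t a : R).

(** On functions of mean zero, the moment of order q decays like exp (- a t),
    up to the factor 4. *)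
Definition moment_decay a q := forall t f, 0 <= t -> f \in Lfun mu q%:E ->
  \int[mu]_x f x = 0 ->
  moment mu q (semigroup P t f) <= 4 * expR (- (a * t)) * moment mu q f.

Lemma moment_decay_slow q : 2 <= q -> moment_decay (1 / C) q.
Proof.
move=> q2 t f t0 fq f0.
have aE : 1 / C * t = t / C by rewrite mul1r mulrC.
have [q4|q4] := leP q 4.
  by rewrite aE; exact: (moment_decay_le4 ss C0 L2dec).
apply: (le_trans (moment_decay_ge4 ss C0 L2dec (ltW q4) t0 fq f0)).
rewrite ler_wpM2r ?moment_ge0// ler_wpM2l// ler_expR lerN2 aE.
by rewrite ler_pM2r ?invr_gt0// ler_peMl// ler1n.
Qed.

Lemma moment_decay_fast q : 4 <= q -> moment_decay (2 / C) q.
Proof.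
move=> q4 t f t0 fq f0; rewrite [2 / C * t]mulrAC.
exact: (moment_decay_ge4 ss C0 L2dec).
Qed.

(** The factor 4 on the moment of order q becomes 4^(1/q) on the norm. *)
Lemma Lp_decay_moment a q (K l : R) : 1 <= q -> moment_decay a q ->
  l * q = a -> 4 `^ q^-1 <= K -> Lp_decay mu P q K l.
Proof.
move=> q1 dec lq K4; have q0 : 0 < q by rewrite (lt_le_trans ltr01).
apply: (centered_decay ss q1) => t f t0 fq f0.
have c0 : 0 <= 4 * expR (- (a * t)) by rewrite mulr_ge0// expR_ge0.
apply: (le_trans (rnorm_le q1 c0 (dec t f t0 fq f0))).
rewrite powRM ?expR_ge0// -expRM -lq.
have -> : - (l * q * t) / q = - (l * t) by field; rewrite gt_eqF.
by rewrite ler_wpM2r ?rnorm_ge0// ler_wpM2r// expR_ge0.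
Qed.

Lemma Lp_decay_dual a p q (l : R) : 1 < p -> p < 2 -> p^-1 + q^-1 = 1 ->
  moment_decay a q -> l * q = a -> Lp_decay mu P p 2 l.
Proof.
move=> p1 p2 pq dec lq.
have q0 : 0 < q.
  rewrite -invr_gt0 -(addKr p^-1 q^-1) pq addrC subr_gt0 invf_lt1//.
  exact: lt_trans p1.
apply: (centered_decay ss (ltW p1)) => t f t0 fp f0.
have := dual_decay ss p1 p2 pq t0 (expR_ge0 (- (a * t)))
  (fun g gq g0 => dec t g t0 gq g0) fp f0.
rewrite -expRM -lq.
by have -> : - (l * q * t) / q = - (l * t) by field; rewrite gt_eqF.
Qed.

End Conclusion.

Theorem theorem1p5 (R : realType) (E : completePseudoMetricType R)
    (dO : measure_display) (O : measurableType dO)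
    (mu : probability (borel E) R)
    (P : R -> R.-pker (borel E) ~> (borel E))
    (Pr : probability O R) (F : R -> set (set O)) (X : R -> O -> borel E)
    (D : set (E -> R)) (L : (E -> R) -> E -> R) (C_P : R) :
  symmetric_diffusion mu P Pr F X D L ->
  0 < C_P ->
  poincare mu D L C_P ->
  [/\ forall p : R, 2 < p ->
        Lp_decay mu P p (4 `^ (1 - 1 / p)) (1 / (p * C_P)),
      forall k : nat, (1 <= k)%N ->
        Lp_decay mu P (2 ^+ k) (4 `^ (1 - 2 / 2 ^+ k)) (2 / (2 ^+ k * C_P)) &
      forall p : R, 1 < p -> p < 2 ->
        Lp_decay mu P p 2 (1 / (p / (p - 1) * C_P)) /\
        (forall k : nat, (1 <= k)%N -> p / (p - 1) = 2 ^+ k ->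
          Lp_decay mu P p 2 (2 / (2 ^+ k * C_P)))].
Proof.
move=> sd C0 poin.
have ss : symmetric_semigroup mu P.
  by split; [exact: sd_transition sd|exact: sd_symmetric sd|exact: sd_contraction sd].
have dir f : D f -> Var mu f <= C_P * dirichlet mu L f.
  by move=> Df; rewrite (sd_dirichlet sd Df); exact: poin.
have L2dec (t : R) (f : borel E -> R) : 0 <= t -> f \in Lfun mu 2%:E ->
    \int[mu]_x f x = 0 ->
    rnorm mu 2 (semigroup P t f) <= expR (- (t / C_P)) * rnorm mu 2 f.
  exact: (L2_decay ss C0 (sd_core sd) (sd_algebra sd) dir).
have slow := moment_decay_slow ss C0 L2dec.
have fast := moment_decay_fast ss C0 L2dec.
have pow4 (a b : R) : a <= b -> (4 : R) `^ a <= 4 `^ b.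
  by apply: ler_powR; rewrite ler1n.
have pow2 k : (2 <= k)%N -> 4 <= 2 ^+ k :> R.
  by move=> k2; rewrite (_ : 4 = 2 ^+ 2) ?ler_eXn2l ?ltr1n// -natrX.
split.
- move=> p p2; have p0 : 0 < p by lra.
  apply: (Lp_decay_moment ss _ (slow p (ltW p2))); first lra.
    by field; rewrite !gt_eqF.
  apply: pow4; rewrite lerBrDr div1r -[leLHS]mulr2n -mulr_natr.
  by rewrite mulrC ler_pdivrMr// mul1r ltW.
- case=> [//|[_|k _]].
    (* order 2: the decay of the variance itself *)
    rewrite expr1; apply: (centered_decay ss); first by rewrite ler1n.
    move=> t f t0 f2 f0; rewrite divff// subrr powRr0 mul1r.
    rewrite (_ : 2 / (2 * C_P) * t = t / C_P); first exact: L2dec.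
    by field; rewrite gt_eqF.
  have p4 := pow2 k.+2 isT; set p := 2 ^+ _ in p4 *; have p0 : 0 < p by lra.
  apply: (Lp_decay_moment ss _ (fast p p4)); first lra.
    by field; rewrite !gt_eqF.
  apply: pow4; rewrite lerBrDr.
  have : 3 / p <= 1 by rewrite ler_pdivrMr//; lra.
  lra.
- move=> p p1 p2; have p0 : 0 < p by lra.
  have pm0 : 0 < p - 1 by lra.
  set q := p / (p - 1).
  have pq : p^-1 + q^-1 = 1.
    by rewrite /q invf_div; field; rewrite gt_eqF.
  have q2 : 2 < q by rewrite ltr_pdivlMr//; lra.
  have q0 : 0 < q by lra.
  split=> [|k k1 qk].
    apply: (Lp_decay_dual ss p1 p2 pq (slow q (ltW q2))).
    by field; rewrite !gt_eqF.
  have q4 : 4 <= q.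
    rewrite qk; apply: pow2; case: k k1 qk => [//|[|//]] _ qk.
    by rewrite qk expr1 ltxx in q2.
  rewrite -qk; apply: (Lp_decay_dual ss p1 p2 pq (fast q q4)).
  by field; rewrite !gt_eqF.
Qed.
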